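(* Let $\Delta=(\Sigma,C,w)$ be a complete simplicial multi-fan in a lattice $N$ of rank $n$, let $\mathcal V=\{v_i\}_{i\in\Sigma^{(1)}}$ be a set of edge vectors for $\Delta$, let $1\le k\le n$, and let $x\in H_T^{2k}(\Delta,\mathcal V)_{\mathbb Q}$. Then for any $\xi\in H_T^2(\Delta)_{\mathbb Q}$, $$p_*(e^{\xi}x)=\sum_{J\in\Sigma^{(k)}}\mu(x,J)\,p_*(e^{\xi}x_J)\qquad\text{in } \mathrm{Rat}(G_{n-k+1}(N_{\mathbb Q}))_0 ,$$ where $x_J=\prod_{j\in J}x_j$ and $\mathrm{Rat}(G_{n-k+1}(N_{\mathbb Q}))_0$ is the field of rational functions of degree $0$ on the Grassmannian of $(n-k+1)$-planes in $N_{\mathbb Q}$.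
   Context: **Multi-fans.** $N$ is a lattice of rank $n$, $M=N^*=\mathrm{Hom}(N,\mathbb Z)$; subscripts $\mathbb Q,\mathbb R$ denote tensoring with $\mathbb Q,\mathbb R$. A simplicial multi-fan in $N$ is a triple $\Delta=(\Sigma,C,w)$: $\Sigma=\bigsqcup_{k=0}^n\Sigma^{(k)}$ is a finite augmented simplicial complex, $\Sigma^{(k)}$ being the set of simplices with $k$ vertices, $\Sigma^{(0)}=\{o\}$, $o=\emptyset$; $\Sigma^{(n)}\neq\emptyset$ and every $J\in\Sigma$ is contained in some $I\in\Sigma^{(n)}$; $C$ sends each $J\in\Sigma^{(k)}$ to a $k$-dimensional strongly convex rational polyhedral cone in $N_{\mathbb R}$, such that if $J$ is a face of $I$ then $C(J)$ is a face of $C(I)$, and for each $I$ the restriction of $C$ to the faces of $I$ is an isomorphism of ordered sets onto the set of faces of $C(I)$; $w:\Sigma^{(n)}\to\mathbb Z$ is a map. For $K\in\Sigma$, $N_K$ is the minimal primitive sublattice of $N$ containing $N\cap C(K)$, $N^K=N/N_K$, $\Sigma_K=\{J\in\Sigma: K\subset J\}$ (graded by $|J|-|K|$), $C_K(J)$ is the image of $C(J)$ in $N^K_{\mathbb R}$, and $\Delta_K=(\Sigma_K,C_K,w|_{\Sigma_K^{(n-|K|)}})$ is the projected multi-fan in $N^K$. A vector is generic for a multi-fan if it lies on no linear subspace spanned by a cone of the multi-fan of less than maximal dimension. $\Delta$ is pre-complete if $d_v=\sum_{I\in\Sigma^{(n)},\,v\in C(I)}w(I)$ is independent of the generic vector $v$;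 $\Delta$ is complete if $\Delta_K$ is pre-complete for every $K\in\Sigma$. **Face ring and push-forward.** $\mathcal V=\{v_i\}_{i\in\Sigma^{(1)}}$ consists of non-zero vectors $v_i\in N\cap C(i)$, not necessarily primitive. $H_T^*(\Delta)$ (written $H_T^*(\Delta,\mathcal V)$ to stress the module structure below) is the quotient of $\mathbb Z[x_i\mid i\in\Sigma^{(1)}]$, $\deg x_i=2$, by the ideal generated by the $x_K=\prod_{i\in K}x_i$ with $K\subset\Sigma^{(1)}$, $K\notin\Sigma$. $H_T^*(pt)=\mathrm{Sym}^*(M)$ with $M$ in degree $2$; it acts on $H_T^*(\Delta,\mathcal V)$ via $u\mapsto\sum_{i\in\Sigma^{(1)}}\langle u,v_i\rangle x_i$. For $I\in\Sigma^{(n)}$, $\{u_i^I\}_{i\in I}\subset M_{\mathbb Q}$ is the basis dual to $\{v_i\}_{i\in I}$, and $\iota_I^*:H_T^*(\Delta)_{\mathbb Q}\to H_T^*(pt)_{\mathbb Q}$ is the ring homomorphism with $\iota_I^*(x_i)=u_i^I$ for $i\in I$ and $\iota_I^*(x_i)=0$ for $i\notin I$. Let $H_{I,\mathcal V}=N_I/N_{I,\mathcal V}$ with $N_{I,\mathcal V}$ the sublattice generated by $\{v_i\}_{i\in I}$. Put $$\pi_*(x)=\sum_{I\in\Sigma^{(n)}}\frac{w(I)\,\iota_I^*(x)}{|H_{I,\mathcal V}|\prod_{i\in I}u_i^I}.$$ For complete $\Delta$ this lies in $H_T^*(pt)_{\mathbb Q}$ (known), and $p_*:H_T^*(\Delta)_{\mathbb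 Q}\to\mathbb Q$ is $\pi_*$ followed by projection to the degree $0$ part $H_T^0(pt)_{\mathbb Q}=\mathbb Q$. It extends to formal series such as $e^\xi x$ (only the component of degree $2n$ contributes). **The coefficients $\mu(x,J)$.** For $J\in\Sigma^{(k)}$, $1\le k\le n$, let $M_J\subset M$ be the annihilator of $N_J$ and $\omega_J=u_1\wedge\dots\wedge u_{n-k}\in\bigwedge^{n-k}M$ for an (oriented) basis $u_1,\dots,u_{n-k}$ of $M_J$. Put $f^J(x_i)=\iota_I^*(x_i)\wedge\omega_J\in\bigwedge^{n-k+1}M_{\mathbb Q}$ for any $I\in\Sigma^{(n)}$ with $J\subset I$ (independent of $I$), and extend to a ring homomorphism $f^J:H_T^*(\Delta)_{\mathbb Q}\to S^*(\bigwedge^{n-k+1}M_{\mathbb Q})$ into the symmetric algebra. For $x\in H_T^{2k}(\Delta)_{\mathbb Q}$, $f^J(x)/f^J(x_J)$ has degree $0$ and is independent of the orientation of the basis; it is regarded as a rational function of degree $0$ on $\mathbb P(\bigwedge^{n-k+1}N_{\mathbb Q})$. With $\nu:G_{n-k+1}(N_{\mathbb Q})\to\mathbb P(\bigwedge^{n-k+1}N_{\mathbb Q})$ the Plücker embedding, $\mu(x,J)=\nu^*\big(f^J(x)/f^J(x_J)\big)\in\mathrm{Rat}(G_{n-k+1}(N_{\mathbb Q}))_0$. *)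

(* Defs.v *)
From HB Require Import structures.
From mathcomp Require Import all_boot all_order all_algebra fraction.
From mathcomp Require Import generic_quotient ring_quotient.
From mathcomp Require Import finmap boolp classical_sets cardinality reals.
From mathcomp Require Import mpoly.

Set Implicit Arguments.
Unset Strict Implicit.
Unset Printing Implicit Defensive.

Import Order.TTheory GRing.Theory Num.Theory.

Local Open Scope ring_scope.
Local Open Scope quotient_scope.
Local Open Scope classical_set_scope.

(* Conventions: the lattice N is Z^n, as row vectors 'rV[int]_n, with            *)
(* N_Q = 'rV[rat]_n and N_R = 'rV[R]_n; the dual M = Hom(N, Z) is also           *)
(* 'rV[int]_n, acting on N by the pairing [pair].                                *)

Definition pair (F : pzRingType) (n : nat) (u v : 'rV[F]_n) : F :=
  \sum_(a < n) u 0 a * v 0 a.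

Definition rat_of_vec (n : nat) (v : 'rV[int]_n) : 'rV[rat]_n := map_mx intr v.

Section Cones.
Variables (R : realType) (n : nat).
Implicit Types (A F : set 'rV[R]_n).

Definition real_of_vec (v : 'rV[int]_n) : 'rV[R]_n := map_mx intr v.

Definition linspan A : set 'rV[R]_n :=
  [set x | exists r (g : 'M[R]_(r, n)) (c : 'rV[R]_r),
             (forall i, A (row i g)) /\ x = c *m g].

Definition rational_polyhedral A :=
  exists r (g : 'M[int]_(r, n)),
    A = [set x | exists2 c : 'rV[R]_r, forall i, 0 <= c 0 i
                                     & x = c *m map_mx intr g].

Definition strongly_convex A := forall x, A x -> A (- x) -> x = 0.

Definition cone_dim A (k : nat) :=
  exists2 B : 'M[R]_(k, n), row_free B
                          & linspan A = [set x : 'rV[R]_n | (x <= B)%MS].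

Definition face_of F A :=
  exists2 u : 'rV[R]_n, forall x, A x -> 0 <= pair u x
                      & F = [set x | A x /\ pair u x = 0].

End Cones.

Section Lattices.
Variable n : nat.
Implicit Types (L : set 'rV[int]_n).

Definition sublattice L := L 0 /\ forall x y, L x -> L y -> L (x - y).

Definition primitive_sublattice L :=
  sublattice L /\ forall (a : int) x, a != 0 -> L (a *: x) -> L x.

Definition primitive_hull (A : set 'rV[int]_n) : set 'rV[int]_n :=
  [set x | forall L, primitive_sublattice L -> A `<=` L -> L x].

(* The order of the quotient L / L': its elements are the cosets x + L'.         *)
(* [fset_set] is empty, so the value is 0, if there are infinitely many.         *)
Definition lattice_index L L' : nat :=
  #|` fset_set [set [set y | L' (y - x)] | x in L] |%fset.

Definition lattice_basis (r : nat) (B : 'M[int]_(r, n)) L :=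
  (forall x, L x <-> exists c : 'rV[int]_r, x = c *m B)
  /\ (forall c : 'rV[int]_r, c *m B = 0 -> c = 0).

End Lattices.

(* Vertices are the elements of 'I_(nvert D). The values of [cone] off the       *)
(* complex and of [weight] off its top simplices are irrelevant. [complex_pure]  *)
(* contains that every simplex has at most n vertices and, as set0 is a simplex, *)
(* that simplices with n vertices exist.                                         *)
Record multifan (R : realType) (n : nat) := Multifan {
  nvert : nat;
  complex : {set {set 'I_nvert}};
  cone : {set 'I_nvert} -> set 'rV[R]_n;
  weight : {set 'I_nvert} -> int;
  complex0 : finset.set0 \in complex;
  complex_vertex : forall i, [set i]%SET \in complex;
  complex_sub : forall I J : {set 'I_nvert},
    I \in complex -> J \subset I -> J \in complex;
  complex_pure : forall J, J \in complex ->
    exists I, [/\ I \in complex, #|I| = n & J \subset I];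
  cone_rational : forall J, J \in complex -> rational_polyhedral (cone J);
  cone_strongly_convex : forall J, J \in complex -> strongly_convex (cone J);
  cone_dimE : forall J, J \in complex -> cone_dim (cone J) #|J|;
  cone_face : forall I J : {set 'I_nvert},
    I \in complex -> J \subset I -> face_of (cone J) (cone I);
  cone_order : forall I J1 J2 : {set 'I_nvert},
    I \in complex -> J1 \subset I -> J2 \subset I ->
    (J1 \subset J2 <-> cone J1 `<=` cone J2);
  cone_face_onto : forall (I : {set 'I_nvert}) F,
    I \in complex -> face_of F (cone I) ->
    exists2 J : {set 'I_nvert}, J \subset I & F = cone J
}.

Section MultiFan.
Variables (R : realType) (n : nat) (D : multifan R n).
Notation s := (nvert D).
Implicit Types (I J K : {set 'I_s}).

Definition simplices (k : nat) : {set {set 'I_s}} :=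
  [set J in complex D | #|J| == k]%SET.

Definition cone_lattice K : set 'rV[int]_n :=
  primitive_hull [set v | cone K (real_of_vec R v)].

Definition annihilator J : set 'rV[int]_n :=
  [set u | forall x, cone_lattice J x -> pair u x = 0].

(* The projected multi-fan D_K lives in the quotient of N_R by (N_K)_R. Vectors  *)
(* of this quotient are represented by their lifts to N_R, and its subsets by    *)
(* their preimages in N_R.                                                       *)
Definition proj_cone K J : set 'rV[R]_n :=
  [set x | exists2 c, cone J c
                    & linspan [set real_of_vec R v | v in cone_lattice K] (x - c)].

Definition proj_generic K (x : 'rV[R]_n) :=
  forall J, J \in complex D -> K \subset J -> (#|J| < n)%N ->
    ~ linspan (proj_cone K J) x.

Definition proj_degree K (x : 'rV[R]_n) : int :=
  \sum_(I in simplices n | (K \subset I) && `[< proj_cone K I x >]) weight I.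

Definition proj_precomplete K :=
  forall x y, proj_generic K x -> proj_generic K y ->
    proj_degree K x = proj_degree K y.

Definition complete := forall K, K \in complex D -> proj_precomplete K.

Definition edge_vectors (v : 'I_s -> 'rV[int]_n) :=
  forall i, v i != 0 /\ cone [set i]%SET (real_of_vec R (v i)).

(* The ideal generated by the monomials x_K, K not a simplex. *)
Definition face_ideal : {pred {mpoly rat[s]}} :=
  fun p => `[< exists a : {set 'I_s} -> {mpoly rat[s]},
                 p = \sum_(K : {set 'I_s} | K \notin complex D)
                       a K * \prod_(i in K) 'X_i >].

Lemma face_ideal_closed : idealr_closed face_ideal.
Proof.
split=> [||r p q /asboolP[a ->] /asboolP[b ->]].
- by apply/asboolP; exists (fun=> 0); rewrite big1 // => K _; rewrite mul0r.
- apply/negP => /asboolP[a /(congr1 (meval (fun=> 0)))].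
  rewrite meval1 raddf_sum big1 /= => [/eqP|K KD]; first by rewrite oner_eq0.
  have /set0Pn[i iK] : K != finset.set0.
    by apply: contra KD => /eqP ->; apply: complex0.
  by rewrite mevalM (big_setD1 i) //= mevalM mevalXU mul0r mulr0.
- apply/asboolP; exists (fun K => r * a K + b K).
  rewrite mulr_sumr -big_split; apply: eq_bigr => K _ /=.
  by rewrite mulrDl mulrA.
Qed.

HB.instance Definition _ := isIdealr.Build _ face_ideal face_ideal_closed.

(* H_T^*(D)_Q *)
Definition face_ring := {ideal_quot face_ideal}.
HB.instance Definition _ := GRing.ComNzRing.on face_ring.

Definition face_class (p : {mpoly rat[s]}) : face_ring :=
  \pi_({ideal_quot face_ideal}) p.

Definition face_monomial J : face_ring := face_class (\prod_(j in J) 'X_j).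

(* Membership in the part of topological degree 2d. *)
Definition face_degree (d : nat) (x : face_ring) :=
  exists2 p : {mpoly rat[s]}, p \is d.-homog & x = face_class p.

(* The Q-algebra homomorphism with x_i |-> h i; it does not depend on the chosen *)
(* representative as soon as h kills the x_K, K not a simplex.                   *)
Definition face_eval (N : nat) (h : 'I_s -> {mpoly rat[N]}) (x : face_ring) :
    {mpoly rat[N]} :=
  mmap (@mpolyC N rat) h (repr x).

Lemma face_eval_class (N : nat) (h : 'I_s -> {mpoly rat[N]}) p :
    (forall K, K \notin complex D -> \prod_(i in K) h i = 0) ->
  face_eval h (face_class p) = mmap (@mpolyC N rat) h p.
Proof.
move=> hK; apply/eqP; rewrite -subr_eq0 -raddfB /=.
have /asboolP[a ->] : repr (face_class p) - p \in face_ideal.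
  by rewrite Quotient.idealrBE reprK.
rewrite raddf_sum big1 //= => K /hK hK0.
rewrite rmorphM rmorph_prod /= (eq_bigr h) ?hK0 ?mulr0 // => i _.
by rewrite mmapX mmap1U.
Qed.

End MultiFan.

Arguments face_class {R n} D p.
Arguments face_monomial {R n} D J.

Definition linear_form (N : nat) (a : 'rV[rat]_N) : {mpoly rat[N]} :=
  \sum_(i < N) a 0 i *: 'X_i.

Section PushForward.
Variables (R : realType) (n : nat) (D : multifan R n).
Notation s := (nvert D).
Variable v : 'I_s -> 'rV[int]_n.
Implicit Types (I J K : {set 'I_s}).

(* u_i^I, for i in I *)
Definition dual_vector I (i : 'I_s) : 'rV[rat]_n :=
  xget 0 [set u | forall j, j \in I -> pair u (rat_of_vec (v j)) = (i == j)%:R].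

(* iota_I^*(x_i), as an element of M_Q *)
Definition iota_vertex I (i : 'I_s) : 'rV[rat]_n :=
  if i \in I then dual_vector I i else 0.

(* iota_I^*, with H_T^*(pt)_Q = Sym(M_Q) = Q['X_0, .., 'X_(n-1)] *)
Definition iota_star I : face_ring D -> {mpoly rat[n]} :=
  face_eval (fun i => linear_form (iota_vertex I i)).

Lemma iota_star_class I p : I \in complex D ->
  iota_star I (face_class D p)
  = mmap (@mpolyC n rat) (fun i => linear_form (iota_vertex I i)) p.
Proof.
move=> ID; apply: face_eval_class => K KD.
have /subsetPn[i iK iI] : ~~ (K \subset I).
  by apply: contra KD; apply: complex_sub ID.
rewrite (big_setD1 i) //= /iota_vertex (negPf iI) /linear_form.
by rewrite big1 ?mul0r // => a _; rewrite mxE scale0r.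
Qed.

Definition edge_lattice I : set 'rV[int]_n :=
  [set x | exists c : 'I_s -> int, x = \sum_(i in I) c i *: v i].

(* |H_{I,V}| *)
Definition edge_index I : nat :=
  lattice_index (cone_lattice (D := D) I) (edge_lattice I).

(* pi_*, with values in the fraction field of H_T^*(pt)_Q *)
Definition push_pi (x : face_ring D) : {fraction {mpoly rat[n]}} :=
  \sum_(I in simplices D n)
    (weight I)%:~R * tofrac (iota_star I x)
    / ((edge_index I)%:R
       * tofrac (\prod_(i in I) linear_form (dual_vector I i))).

(* p_*: for complete D, [push_pi x] is the image of a unique polynomial, whose   *)
(* constant term is taken.                                                       *)
Definition push_p (x : face_ring D) : rat :=
  (xget 0 [set P : {mpoly rat[n]} | tofrac P = push_pi x])@_0%MM.

(* p_*(e^xi x) for xi of degree 2: the components of xi ^+ j * x have degree     *)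
(* larger than 2n for j > n, so that p_* vanishes on them.                       *)
Definition push_p_exp (xi x : face_ring D) : rat :=
  \sum_(j < n.+1) (j`!%:R)^-1 * push_p (xi ^+ j * x).

End PushForward.

(* Quotients of homogeneous polynomials of the same degree, read in a field.     *)
Section DegreeZero.
Variables (N : nat) (F : fieldType) (phi : {rmorphism {mpoly rat[N]} -> F}).

Definition degree0 : {pred F} :=
  fun f => `[< exists d (P Q : {mpoly rat[N]}),
    [/\ P \is d.-homog, Q \is d.-homog, phi Q != 0 & f = phi P / phi Q] >].

Lemma degree0_closed : divring_closed degree0.
Proof.
split=> [|f g /asboolP[d [P [Q [hP hQ Q0 ->]]]] /asboolP[e [S [T [hS hT T0 ->]]]]
         |f g /asboolP[d [P [Q [hP hQ Q0 ->]]]] /asboolP[e [S [T [hS hT T0 ->]]]]];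
  apply/asboolP.
- by exists 0, 1, 1; rewrite rmorph1 divr1 oner_neq0 dhomog1.
- exists (d + e)%N, (P * T - S * Q), (Q * T); split.
  + by rewrite rpredB //; [|rewrite addnC]; apply: dhomogM.
  + exact: dhomogM.
  + by rewrite rmorphM mulf_neq0.
  + by rewrite raddfB /= -mulNr addf_div // (rmorphM phi P) (rmorphM phi S) (rmorphM phi Q) (mulNr (phi S)).
- have [S0|S0] := eqVneq (phi S) 0.
    exists 0, 0, 1.
    rewrite S0 mul0r invr0 mulr0 rmorph0 mul0r rmorph1 oner_neq0.
    by split; rewrite ?dhomog0 ?dhomog1.
  exists (d + e)%N, (P * T), (Q * S); split; try exact: dhomogM.
    by rewrite rmorphM mulf_neq0.
  by rewrite !rmorphM /= invf_div mulf_div.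
Qed.

HB.instance Definition _ := GRing.isDivringClosed.Build _ degree0 degree0_closed.

Record degree0_field := Degree0Field {
  degree0_val :> F;
  degree0P : degree0_val \in degree0
}.

HB.instance Definition _ := [isSub for degree0_val].
HB.instance Definition _ := [Choice of degree0_field by <:].
HB.instance Definition _ := [SubChoice_isSubComUnitRing of degree0_field by <:].
HB.instance Definition _ :=
  [SubComUnitRing_isSubIntegralDomain of degree0_field by <:].
HB.instance Definition _ := [SubIntegralDomain_isSubField of degree0_field by <:].

(* The fraction P / Q; meant for P and Q homogeneous of the same degree and      *)
(* phi Q != 0.                                                                   *)
Definition degree0_frac (P Q : {mpoly rat[N]}) : degree0_field :=
  insubd (0 : degree0_field) (phi P / phi Q).

Lemma degree0_fracE d (P Q : {mpoly rat[N]}) :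
    P \is d.-homog -> Q \is d.-homog -> phi Q != 0 ->
  val (degree0_frac P Q) = phi P / phi Q.
Proof.
by move=> hP hQ Q0; rewrite insubdK //; apply/asboolP; exists d, P, Q.
Qed.

Definition degree0_const (c : rat) : degree0_field := degree0_frac c%:MP 1.

Lemma degree0_constE c : val (degree0_const c) = phi c%:MP.
Proof.
rewrite (@degree0_fracE 0) ?rmorph1 ?divr1 ?oner_neq0 ?dhomog1 //.
by rewrite -[_%:MP]mulr1 mul_mpolyC dhomogZ ?dhomog1.
Qed.

End DegreeZero.

(* The basis e_t, t an increasing m-tuple of indices, of the m-th exterior power *)
(* of a space with basis (e_i)_(i < n).                                          *)
Definition increasing_tuples (m n : nat) : {set m.-tuple 'I_n} :=
  [set t : m.-tuple 'I_n | sorted ltn [seq val i | i <- t]]%SET.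

Notation ext_dim m n := #|increasing_tuples m n|.

(* Exterior product of the rows of A in this basis: the m x m minors of A. *)
Definition wedge (F : comNzRingType) (m n : nat) (A : 'M[F]_(m, n)) :
    'rV[F]_(ext_dim m n) :=
  \row_t \det (colsub (tnth (enum_val t)) A).

Section Grassmannian.
Variables (m n : nat).

(* The ideal, in Sym(Lambda^m M_Q), of polynomial functions on Lambda^m N_Q that *)
(* vanish on all decomposable m-vectors, i.e. on the affine cone over the image  *)
(* of the Grassmannian of m-planes in N_Q under the Pluecker embedding.          *)
Definition pluecker_ideal : {pred {mpoly rat[ext_dim m n]}} :=
  fun P => `[< forall A : 'M[rat]_(m, n), P.@[fun t => wedge A 0 t] = 0 >].

Lemma pluecker_ideal_closed : idealr_closed pluecker_ideal.
Proof.
split=> [||r p q /asboolP hp /asboolP hq]; first by apply/asboolP => A; rewrite meval0.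
- by apply/negP => /asboolP /(_ 0) /eqP; rewrite meval1 oner_eq0.
- by apply/asboolP => A; rewrite mevalD mevalM hp hq mulr0 addr0.
Qed.

Lemma wedge_line (P : {mpoly rat[ext_dim m n]}) (A B : 'M[rat]_(m, n)) :
  exists p : {poly rat},
    forall a, p.[a] = P.@[fun t => wedge (A + a *: (B - A)) 0 t].
Proof.
pose C : 'M[{poly rat}]_(m, n) :=
  map_mx polyC A + 'X *: map_mx polyC (B - A).
exists (mmap polyC (fun t => wedge C 0 t) P) => a.
rewrite mevalE /mmap -[LHS]/(horner_eval a _) raddf_sum /=.
apply: eq_bigr => mm _; rewrite rmorphM /= /horner_eval hornerC; congr (_ * _).
rewrite -[LHS]/(horner_eval a _) rmorph_prod; apply: eq_bigr => t _.
rewrite rmorphXn /=; congr (_ ^+ _); rewrite !mxE -det_map_mx; congr (\det _).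
by apply/matrixP => i j; rewrite !mxE /= /horner_eval !hornerE.
Qed.

Lemma pluecker_ideal_prime : prime_idealr_closed pluecker_ideal.
Proof.
move=> P Q /asboolP PQ0; apply/norP => -[/asboolP nP /asboolP nQ].
have [A PA] : exists A : 'M_(m, n), P.@[fun t => wedge A 0 t] != 0.
  by apply: contrapT => /forallNP h; apply: nP => A; apply/eqP/negPn/negP/h.
have [B QB] : exists B : 'M_(m, n), Q.@[fun t => wedge B 0 t] != 0.
  by apply: contrapT => /forallNP h; apply: nQ => B; apply/eqP/negPn/negP/h.
have [p pE] := wedge_line P A B; have [q qE] := wedge_line Q A B.
have p0 : p != 0.
  apply: contra PA => /eqP p0; have := pE 0.
  by rewrite p0 horner0 scale0r addr0 => <-.
have q0 : q != 0.
  apply: contra QB => /eqP q0; have := qE 1.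
  by rewrite q0 horner0 scale1r addrC subrK => <-.
have pq0 : p * q != 0 by rewrite mulf_neq0.
pose rs := [seq (i%:R : rat) | i <- iota 0 (size (p * q))].
have := @max_poly_roots _ _ rs pq0; rewrite size_map size_iota ltnn.
suff [-> ->] : all (root (p * q)) rs /\ uniq rs by move=> /(_ isT isT).
split; last by rewrite map_inj_uniq ?iota_uniq // => i j /eqP; rewrite eqr_nat => /eqP.
by apply/allP => a _; rewrite rootE hornerM pE qE -mevalM PQ0.
Qed.

HB.instance Definition _ := isIdealr.Build _ pluecker_ideal pluecker_ideal_closed.
HB.instance Definition _ :=
  isPrimeIdealrClosed.Build _ pluecker_ideal pluecker_ideal_prime.

(* The homogeneous coordinate ring of the Grassmannian. *)
Definition grass_ring := {ideal_quot pluecker_ideal}.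
HB.instance Definition _ := GRing.ComNzRing.on grass_ring.

Definition grass_unit : {pred grass_ring} :=
  fun x => `[< exists y : grass_ring, y * x = 1 >].
Definition grass_inv (x : grass_ring) : grass_ring :=
  if x \in grass_unit then xget 0 [set y : grass_ring | y * x = 1] else x.

Lemma grass_mulVr : {in grass_unit, left_inverse 1 grass_inv *%R}.
Proof.
move=> x xU; rewrite /grass_inv xU; move/asboolP: xU => [y yx].
by case: xgetP => [z _ //|/(_ y)/(_ yx)].
Qed.

Lemma grass_unitP (x y : grass_ring) : y * x = 1 -> x \in grass_unit.
Proof. by move=> yx; apply/asboolP; exists y. Qed.

Lemma grass_inv_out : {in [predC grass_unit], grass_inv =1 id}.
Proof. by move=> x; rewrite inE /= /grass_inv => /negPf ->. Qed.

HB.instance Definition _ := GRing.ComNzRing_hasMulInverse.Build grass_ring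
  grass_mulVr grass_unitP grass_inv_out.

Lemma grass_idomain : GRing.integral_domain_axiom grass_ring.
Proof. exact: Quotient.rquot_IdomainAxiom. Qed.

HB.instance Definition _ :=
  GRing.ComUnitRing_isIntegral.Build grass_ring grass_idomain.

(* Pull-back along the Pluecker embedding nu, with values in the fraction field  *)
(* of the homogeneous coordinate ring.                                           *)
Definition grass_pullback (P : {mpoly rat[ext_dim m n]})
    : {fraction grass_ring} :=
  tofrac (\pi_({ideal_quot pluecker_ideal}) P : grass_ring).

Lemma grass_pullback_is_zmod : zmod_morphism grass_pullback.
Proof. by move=> P Q; rewrite /grass_pullback !raddfB. Qed.

Lemma grass_pullback_is_monoid : monoid_morphism grass_pullback.
Proof.
by split=> [|P Q]; rewrite /grass_pullback ?rmorph1 ?rmorphM.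
Qed.

HB.instance Definition _ := GRing.isZmodMorphism.Build
  {mpoly rat[ext_dim m n]} {fraction grass_ring} grass_pullback
  grass_pullback_is_zmod.
HB.instance Definition _ := GRing.isMonoidMorphism.Build
  {mpoly rat[ext_dim m n]} {fraction grass_ring} grass_pullback
  grass_pullback_is_monoid.

Lemma grass_pullback_eq0 P : (grass_pullback P == 0) = (P \in pluecker_ideal).
Proof. by rewrite tofrac_eq0 -[P in RHS]subr0 Quotient.idealrBE raddf0. Qed.

End Grassmannian.

(* Rat(G_m(N_Q))_0 *)
Notation grass_rat0 m n := (degree0_field (@grass_pullback m n)).
Notation grass_const m n := (degree0_const (@grass_pullback m n)).

Section Mu.
Variables (R : realType) (n : nat) (D : multifan R n).
Notation s := (nvert D).
Variables (v : 'I_s -> 'rV[int]_n) (k : nat).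

(* f^J, computed from a simplex I in Sigma^(n) containing J and from the basis   *)
(* of M_J given by the rows of B. The linear form in position i is               *)
(* iota_I^*(x_i) /\ omega_J, where omega_J is the exterior product of the rows   *)
(* of B.                                                                         *)
Definition f_mu (I : {set 'I_s}) (B : 'M[int]_(n - k, n)) :
    face_ring D -> {mpoly rat[ext_dim (n - k).+1 n]} :=
  face_eval (fun i => linear_form
    (wedge (col_mx (iota_vertex v I i) (map_mx intr B) : 'M[rat]_((n - k).+1, n)))).

Definition mu (I : {set 'I_s}) (B : 'M[int]_(n - k, n))
    (x : face_ring D) (J : {set 'I_s}) : grass_rat0 (n - k).+1 n :=
  degree0_frac (@grass_pullback (n - k).+1 n) (f_mu I B x) (f_mu I B (face_monomial D J)).

End Mu.

(* Main.v *)
Require Import Defs.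
From HB Require Import structures.
From mathcomp Require Import all_boot all_order all_algebra fraction.
From mathcomp Require Import fingroup perm.
From mathcomp Require Import generic_quotient ring_quotient.
From mathcomp Require Import finmap boolp classical_sets cardinality reals.
From mathcomp Require Import mpoly.
From mathcomp Require Import zify ring.

(** Let E be a subspace of N_Q of dimension n - k + 1, given as the row space of
    a matrix A. Two facts about pi_* are the basis of the proof: it vanishes in
    degree n - 1 [push_homog_vanish], and it is constant in degree n
    [push_homog_const]. As pi_* is Sym(M)-linear, the first one implies that, in
    degree n, p_* kills all products with an element u of M. Therefore p_*(g x),
    with g of degree n - k, only depends on x modulo the ideal generated by the
    linear forms u that vanish on E.

    Modulo this ideal, every monomial of degree k is a combination of the x_J
    with J in Sigma^(k). Indeed, if a vertex i occurs in it more than once, one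
    chooses u that vanishes on E and on the edge vectors of the other vertices
    of the support and is 1 on v_i; this is possible for generic E
    [plane_separate], and the relation given by u replaces x_i by a combination
    of vertices outside the support. The support grows until the monomial is
    squarefree [face_monomial_ind].

    The coefficient of x_J is found by evaluation on the line in which E meets
    the span of the cone of J: there x_K vanishes for the K different from J,
    and so does every u that vanishes on E. The exterior product with omega_J
    performs this evaluation. By the Cauchy-Binet formula [wedge_dot], the
    linear form iota_I^*(x_i) /\ omega_J takes at the Pluecker point of E the
    value of a determinant, which is a linear function of iota_I^*(x_i), vanishes
    on M_J and on the forms that vanish on E, and hence is a multiple of the
    evaluation on that line. So the coefficient is the value of mu(x, J) at E
    [expansion], and an identity that holds at all generic E holds in the
    function field of the Grassmannian [degree0_identity].

    Both facts about pi_* follow from the same exchange of vertices. In degree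
    n - 1 this reduces the vanishing of pi_* to the monomials x_J of the walls
    J. There it says that the weights on the two sides of the wall have the same
    sum [wall_balance], which is the pre-completeness of the projected multi-fan
    of J; the orders of the groups H_I enter through the proportionality of
    |H_I| u_i^I to one linear form for all cofaces I of J [wall_normal], which
    rests on |H_I| being a determinant [lattice_index_row_lattice]. In degree n
    the exchange reduces the claim to the x_I with I in Sigma^(n), for which the
    product of the u_i^I cancels. *)

Set Implicit Arguments.
Unset Strict Implicit.
Unset Printing Implicit Defensive.

Import Order.TTheory GRing.Theory Num.Theory.

Local Open Scope ring_scope.

(** * Pairings, determinants and exterior products *)

Section Pairing.
Variables (F : comNzRingType) (n : nat).
Implicit Types (u v : 'rV[F]_n).

Lemma pair_mx u v : pair u v = (u *m v^T) 0 0.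
Proof. by rewrite mxE; apply: eq_bigr => a _; rewrite mxE. Qed.

Lemma pairC u v : pair u v = pair v u.
Proof. by apply: eq_bigr => a _; rewrite mulrC. Qed.

Lemma pairDl u1 u2 v : pair (u1 + u2) v = pair u1 v + pair u2 v.
Proof. by rewrite !pair_mx mulmxDl mxE. Qed.

Lemma pairZl a u v : pair (a *: u) v = a * pair u v.
Proof. by rewrite !pair_mx -scalemxAl mxE. Qed.

Lemma pair0l v : pair 0 v = 0.
Proof. by rewrite pair_mx mul0mx mxE. Qed.

Lemma pairDr u v1 v2 : pair u (v1 + v2) = pair u v1 + pair u v2.
Proof. by rewrite pairC pairDl !(pairC u). Qed.

Lemma pairZr a u v : pair u (a *: v) = a * pair u v.
Proof. by rewrite pairC pairZl (pairC u). Qed.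

Lemma pair0r u : pair u 0 = 0.
Proof. by rewrite pairC pair0l. Qed.

Lemma pairBr u v1 v2 : pair u (v1 - v2) = pair u v1 - pair u v2.
Proof. by rewrite -scaleN1r pairDr pairZr mulN1r. Qed.

Lemma pairBl u1 u2 v : pair (u1 - u2) v = pair u1 v - pair u2 v.
Proof. by rewrite pairC pairBr !(pairC v). Qed.

Lemma pair_suml (I : Type) (r : seq I) (P : pred I) (u : I -> 'rV[F]_n) v :
  pair (\sum_(i <- r | P i) u i) v = \sum_(i <- r | P i) pair (u i) v.
Proof.
by apply: (big_morph (fun u => pair u v)) => [x y|]; rewrite ?pairDl ?pair0l.
Qed.

Lemma pair_sumr (I : Type) (r : seq I) (P : pred I) u (v : I -> 'rV[F]_n) :
  pair u (\sum_(i <- r | P i) v i) = \sum_(i <- r | P i) pair u (v i).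
Proof.
by apply: (big_morph (fun v => pair u v)) => [x y|]; rewrite ?pairDr ?pair0r.
Qed.

Lemma pair_map (G : comNzRingType) (f : {rmorphism F -> G}) u v :
  pair (map_mx f u) (map_mx f v) = f (pair u v).
Proof. by rewrite /pair rmorph_sum; apply: eq_bigr => a _; rewrite !mxE rmorphM. Qed.

Lemma pair_delta u a : pair u (delta_mx 0 a) = u 0 a.
Proof.
rewrite /pair (bigD1 a) //= big1 ?addr0 => [|b ne]; rewrite !mxE eqxx ?eqxx ?mulr1 //=.
by rewrite (negPf ne) mulr0.
Qed.

End Pairing.

Section Stack.
Variables (F : comNzRingType) (m p : nat).
Implicit Types (y : 'rV[F]_p) (X : 'M[F]_(m, p)).

(** [col_mx y X] has [1 + m] rows, which is only convertible to [m.+1]; with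
    the retyping, a stack of [m.+1] columns is a square matrix. *)
Definition stack y X : 'M[F]_(m.+1, p) := col_mx y X.

Lemma stack0E y X a : stack y X 0 a = y 0 a.
Proof.
transitivity (col_mx y X (lshift m 0) a); last exact: col_mxEu.
by congr (col_mx y X _ a); apply: val_inj.
Qed.

Lemma stackSE y X q a : stack y X (lift 0 q) a = X q a.
Proof.
transitivity (col_mx y X (rshift 1 q) a); last exact: col_mxEd.
by congr (col_mx y X _ a); apply: val_inj.
Qed.

End Stack.

(** Laplace expansion along the top row: the determinant is a linear form of
    that row, and it vanishes on the other rows because they would occur
    twice. *)
Lemma det_stack (F : comNzRingType) m (X : 'M[F]_(m, m.+1)) :
  exists2 d : 'rV[F]_m.+1,
    forall y, \det (stack y X) = pair d y & forall q, pair d (row q X) = 0.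
Proof.
pose d : 'rV[F]_m.+1 := \row_a cofactor (stack 0 X) 0 a.
have dE y : \det (stack y X) = pair d y.
  rewrite (expand_det_row _ 0) pairC; apply: eq_bigr => a _.
  rewrite stack0E mxE; congr (_ * (_ * \det _)); apply/matrixP => p q.
  have rc (Z : 'M[F]_m.+1) : row' 0 (col' a Z) p q = Z (lift 0 p) (lift a q).
    by rewrite !mxE.
  by rewrite !rc !stackSE.
exists d => // q; rewrite -dE.
apply: (@determinant_alternate _ _ _ 0 (lift 0 q)) => // a.
by rewrite stack0E stackSE mxE.
Qed.

(** Multilinearity of the determinant in the rows of [A *m C], which are linear
    combinations of the rows of [C]: [f i] is the row of [C] chosen for the
    [i]-th row of the product. *)
Lemma det_mulmx_rect (F : comNzRingType) m n (A : 'M[F]_(m, n)) (C : 'M[F]_(n, m)) :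
  \det (A *m C)
  = \sum_(f : {ffun 'I_m -> 'I_n}) (\prod_i A i (f i)) * \det (rowsub f C).
Proof.
pose AB (s : 'S_m) i j := A i j * C j (s i).
transitivity (\sum_(f : {ffun 'I_m -> 'I_n}) \sum_(s : 'S_m)
    (-1) ^+ s * \prod_i AB s i (f i)).
  rewrite exchange_big; apply: eq_bigr => /= s _; rewrite -big_distrr /=.
  congr (_ * _); rewrite -(bigA_distr_bigA (AB s)) /=.
  by apply: eq_bigr => i _; rewrite mxE.
apply: eq_bigr => f _; rewrite big_distrr /=; apply: eq_bigr => s _.
rewrite mulrCA big_split //=; congr (_ * (_ * _)).
by apply: eq_bigr => i _; rewrite mxE.
Qed.

Lemma det_rowsub_perm (F : comNzRingType) m n (C : 'M[F]_(n, m))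
    (g : 'I_m -> 'I_n) (s : 'S_m) :
  \det (rowsub (g \o s) C) = (-1) ^+ s * \det (rowsub g C).
Proof.
have -> : rowsub (g \o s) C = row_perm s (rowsub g C).
  by apply/matrixP => i j; rewrite !mxE.
by rewrite row_permE det_mulmx det_perm.
Qed.

(** The Cauchy-Binet formula. In [det_mulmx_rect] a choice [f] that is not
    injective repeats a row and contributes 0. An injective one is, in a unique
    way, an increasing tuple composed with a permutation; the signs of these
    permutations turn the sum of the products of entries of [A] into a minor. *)
Lemma wedge_dot (F : comNzRingType) m n (A B : 'M[F]_(m, n)) :
  \sum_t wedge A 0 t * wedge B 0 t = \det (A *m B^T).
Proof.
pose h (p : m.-tuple 'I_n * 'S_m) : {ffun 'I_m -> 'I_n} :=
  [ffun i => tnth p.1 (p.2 i)].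
pose X := finset.setX (increasing_tuples m n) [set: 'S_m]%SET.
have tuniq t : t \in increasing_tuples m n -> uniq t.
  rewrite inE => st; rewrite -(map_inj_uniq val_inj).
  by move: st; rewrite ltn_sorted_uniq_leq => /andP[].
have hP (t : m.-tuple 'I_n) s : perm_eq (codom (h (t, s))) t.
  rewrite codomE; apply/tuple_permP; exists s => /=.
  by apply: eq_map => i; rewrite ffunE.
have h_inj : {in X &, injective h}.
  move=> [t s] [t' s']; rewrite !inE !andbT /= => st st' eqh.
  have ett' : t = t'.
    apply/val_inj/(inj_map val_inj)/(irr_sorted_eq ltn_trans ltnn st st').
    apply: perm_mem; apply: perm_map.
    by rewrite -(permPl (hP t s)) eqh; apply: hP.
  rewrite -ett' in eqh *; congr (_, _); apply/permP => i.
  have /tuple_uniqP tinj : uniq t by apply: tuniq; rewrite inE.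
  have /ffunP/(_ i) := eqh; rewrite !ffunE /=.
  exact: tinj.
rewrite det_mulmx_rect (bigID (fun f =>
  f \in [set h p | p in X]%SET)) /= [X in _ + X]big1 ?addr0; last first.
  move=> f fX; have /injectivePn[i1 [i2 ne12 ef]] : ~~ injectiveb f.
    apply: contra fX => f_inj; apply/imsetP.
    have fu : uniq (codom f) := f_inj.
    have sz : size (sort (relpre val leq) (codom f)) == m.
      by rewrite size_sort size_codom card_ord.
    have /tuple_permP[s es] : perm_eq (codom f) (Tuple sz).
      by rewrite perm_sym perm_sort.
    exists (Tuple sz, s).
      rewrite !inE andbT ltn_sorted_uniq_leq (map_inj_uniq val_inj) sort_uniq.
      by rewrite fu sorted_map sort_sorted // => i j; apply: leq_total.
    apply/ffunP => i; rewrite !ffunE /=.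
    by have /eq_in_map/(_ i (mem_enum _ _)) := es.
  by rewrite (determinant_alternate ne12) ?mulr0 // => j; rewrite !mxE ef.
rewrite big_imset //=.
pose G t s := \prod_i A i (h (t, s) i) * \det (rowsub (h (t, s)) B^T).
rewrite [RHS](eq_big (fun p => (p.1 \in increasing_tuples m n) && (p.2 \in [set:
  'S_m]%SET))
  (fun p => G p.1 p.2)); [|by case=> t s; rewrite finset.in_setX|by case].
rewrite -(pair_big (fun t => t \in increasing_tuples m n) (fun s =>
  s \in [set: 'S_m]%SET) G) /=.
rewrite [RHS]big_enum_val; apply: eq_bigr => t _; rewrite {}/G.
pose u := tnth (enum_val t).
transitivity (\sum_(s : 'S_m) (-1) ^+ s * (\prod_i A i (u (s i)))
  * \det (rowsub u B^T)).
  rewrite -big_distrl /= !mxE; congr (_ * _).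
    by apply: eq_bigr => s _; congr (_ * _); apply: eq_bigr => i _; rewrite mxE.
  by rewrite -det_tr; congr (\det _); apply/matrixP => i j; rewrite !mxE.
apply: eq_big => [s|s _]; first by rewrite inE.
have -> : rowsub (h (enum_val t, s)) B^T = rowsub (u \o s) B^T.
  by apply/matrixP => i j; rewrite !mxE /h ffunE.
rewrite det_rowsub_perm mulrCA !mulrA; congr (_ * _ * _).
by apply: eq_bigr => i _; rewrite /h ffunE.
Qed.

(** * The order of the quotient by a lattice of full rank *)

Lemma card_range (T : finType) (U : choiceType) (f : T -> U) (A : set U) :
  injective f -> (forall x, A x <-> exists i, x = f i) -> #|` fset_set A |%fset = #|T|.
Proof.
move=> fI AE; have -> : A = [set` [fset f i | i in T]%fset]%classic.
  apply/seteqP; split=> x /=.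
    by move=> /AE[i ->]; apply/imfsetP; exists i.
  by move=> /imfsetP[i _ ->]; apply/AE; exists i.
by rewrite set_fsetK card_imfset //= cardE.
Qed.

(** By the Smith normal form, unimodular changes of basis on both sides make [M]
    diagonal with entries [e i]; the quotient is then the product of the Z/e(i),
    whose elements are represented by the tuples of remainders. *)
Lemma lattice_index_row_lattice n (M : 'M[int]_n) (L : set 'rV[int]_n) :
  (forall x, L x <-> exists c : 'rV[int]_n, x = c *m M) -> \det M != 0 ->
  lattice_index [set: 'rV[int]_n]%classic L = `|\det M|%N.
Proof.
move=> LE; have [P uP [Q uQ [d _ eM]]] := int_Smith_normal_form M.
pose e (i : 'I_n) := d`_i.
have LdE x : L x <-> forall i, (x *m invmx Q) 0 i \in dvdz (e i).
  rewrite LE eM; split=> [[c ->] i|dvd].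
    rewrite !mulmxA mulmxK // mxE; apply: rpred_sum => j _.
    rewrite [X in _ * X]mxE; have [->|ne] := eqVneq (j : nat) i; first exact: dvdz_mull.
    by rewrite mulr0n mulr0 dvdz0.
  exists ((\row_i divz ((x *m invmx Q) 0 i) (e i)) *m invmx P).
  rewrite !mulmxA mulmxKV //; apply: (canRL (mulmxKV uQ)); apply/rowP => i.
  rewrite [RHS]mxE (bigD1 i) //= big1 ?addr0 => [|j ne]; last first.
    by rewrite [X in _ * X]mxE (_ : (j == i :> nat) = false) ?mulr0n ?mulr0 //;
      exact: negbTE ne.
  by rewrite [X in _ = X * _]mxE [X in _ * X]mxE eqxx mulr1n divzK //; apply: dvd.
have detM : `|\det M|%N = (\prod_i `|e i|)%N.
  rewrite eM !det_mulmx !abszM.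
  have abs1 (U : 'M[int]_n) : U \in unitmx -> `|\det U|%N = 1%N.
    rewrite unitmxE => uU; have /(congr1 absz) := mulVr uU.
    by rewrite abszM => /eqP; rewrite muln_eq1 => /andP[_ /eqP].
  rewrite (abs1 P uP) (abs1 Q uQ) mul1n muln1 det_trig; last first.
    by apply/is_trig_mxP => i j ltij; rewrite mxE ltn_eqF.
  rewrite (big_morph absz abszM (erefl _)).
  by apply: eq_bigr => i _; rewrite mxE eqxx mulr1n.
rewrite -absz_gt0 detM => prod_gt0.
have e0 i : e i != 0.
  by rewrite -absz_gt0; move: prod_gt0; rewrite (bigD1 i) //= muln_gt0 => /andP[].
pose T := {dffun forall i : 'I_n, 'I_`|e i|}.
pose r (g : T) : 'rV[int]_n := (\row_i (g i)%:Z) *m Q.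
have LB x y : L x -> L y -> L (x - y).
  by rewrite !LE => -[c ->] [c' ->]; exists (c - c'); rewrite mulmxBl.
have LD x y : L x -> L y -> L (x + y).
  by rewrite !LE => -[c ->] [c' ->]; exists (c + c'); rewrite mulmxDl.
have Lr g : r g *m invmx Q = \row_i (g i)%:Z by rewrite mulmxK.
rewrite /lattice_index (@card_range T _ (fun g => [set y | L (y - r g)]%classic)).
- rewrite card_dep_ffun foldrE big_map.
  by rewrite big_enum; apply: eq_big => // i _; rewrite card_ord.
- move=> g g' /= /seteqP[sub _].
  have L0 : L 0 by apply/LE; exists 0; rewrite mul0mx.
  have := sub (r g); rewrite /= subrr => /(_ L0) /LdE dvd.
  apply/ffunP => i; apply/val_inj/eqP; rewrite /= -eqz_nat.
  have := dvd i; rewrite mulmxBl !Lr !mxE -eqz_mod_dvd.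
  have sm (h : T) : ((h i)%:Z %% e i)%Z = (h i)%:Z.
    rewrite -modz_abs; by apply: modz_small; rewrite /= ltz_nat ltn_ord.
  by rewrite !sm.
move=> S; split=> [[x _ <-]|[g ->]]; last by exists (r g).
pose m i : int := modz ((x *m invmx Q) 0 i) (e i).
have lt i : (`|m i| < `|e i|)%N.
  by rewrite -ltz_nat abszE ger0_norm ?modz_ge0 // ltz_mod.
exists [ffun i => Ordinal (lt i)].
have Lxr : L (x - r [ffun i => Ordinal (lt i)]).
  apply/LdE => i; rewrite mulmxBl Lr mxE [X in _ + X]mxE [X in _ - X]mxE ffunE /=.
  rewrite abszE ger0_norm ?modz_ge0 //.
  by rewrite -eqz_mod_dvd modz_mod.
apply/seteqP; split => y /= Ly.
  by rewrite -(subrKA x); apply: LD.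
by rewrite -(subrKA (r [ffun i => Ordinal (lt i)])) -[X in _ + X]opprB; apply: LB.
Qed.

(** * An induction on the monomials of the face ring *)

Lemma subset_card_between (T : finType) (A C : {set T}) k : A \subset C ->
  (#|A| <= k)%N -> (k <= #|C|)%N ->
  exists B : {set T}, [/\ A \subset B, B \subset C & #|B| = k].
Proof.
move=> AC; elim: k => [|k IHk] Ak kC.
  by exists A; rewrite fintype.subxx; split=> //; apply/eqP; rewrite -leqn0.
have [eA|nA] := eqVneq #|A| k.+1; first by exists A; rewrite fintype.subxx.
have [||B [AB BC cB]] := IHk; [by rewrite -ltnS ltn_neqAle nA|exact: ltnW|].
have /subsetPn[x xC xB] : ~~ (C \subset B).
  by apply/negP => /subset_leq_card; rewrite cB leqNgt kC.
exists (x |: B); split.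
- exact/(fintype.subset_trans AB)/finset.subsetUr.
- by rewrite finset.subUset finset.sub1set xC.
- by rewrite cardsU1 xB cB.
Qed.

Definition msupport s (m : 'X_{1..s}) : {set 'I_s} := [set i | m i != 0%N]%SET.

Lemma card_msupport s (m : 'X_{1..s}) : (#|msupport m| = \sum_i (m i != 0))%N.
Proof.
by rewrite -sum1_card big_mkcond; apply: eq_bigr => i _; rewrite inE; case: (m i).
Qed.

(** The exchange argument. A monomial of degree [k] whose support is a simplex
    with less than [k] vertices contains some vertex [i] at least twice. The
    last hypothesis says that one copy of [i] can be traded for vertices outside
    the support. This enlarges the support, so the process ends with monomials
    [x_J], [J] in Sigma^(k), or with monomials supported off the complex. *)
Lemma face_monomial_ind s (C : {set {set 'I_s}}) k (P : 'X_{1..s} -> Prop) :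
    (forall m, mdeg m = k -> msupport m \notin C -> P m) ->
    (forall J, J \in C -> #|J| = k -> P (mesym1 J)) ->
    (forall m i, msupport m \in C -> (#|msupport m| < k)%N -> i \in msupport m ->
       (mdeg m).+1 = k -> (forall l, l \notin msupport m -> P (m + U_(l))%MM) ->
       P (m + U_(i))%MM) ->
  forall m, mdeg m = k -> P m.
Proof.
move=> Pnon Psqf Pstep m; have [c] := ubnP (k - #|msupport m|).
elim: c m => // c IHc m lt_c deg_m.
have [mC|/(Pnon _ deg_m)//] := boolP (msupport m \in C).
have le1 i : ((m i != 0) <= m i)%N by case: (m i).
have [i i2|no2] := pickP (fun i => 1 < m i)%N; last first.
  have m1 i : m i = (m i != 0) :> nat by have := no2 i; case: (m i) => [|[]].
  have -> : m = mesym1 (msupport m).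
    by apply/mnmP => i; rewrite mnmE inE m1 eqb0 negbK; case: (m i).
  apply: Psqf => //; rewrite card_msupport -deg_m mdegE.
  by apply/esym/eq_bigr => i _; apply: m1.
have suppB : msupport (m - U_(i))%MM = msupport m.
  apply/setP => j; rewrite !inE mnmBE mnm1E.
  by have [<-|_] := eqVneq i j; rewrite ?subn0 // -!lt0n subn_gt0 i2 ltnW.
have mE : m = (m - U_(i) + U_(i))%MM.
  by rewrite submK //; apply/mnm_lepP => j; rewrite mnm1E; case: eqVneq => // <-;
    apply: ltnW.
have cardlt : (#|msupport m| < k)%N.
  rewrite card_msupport -deg_m mdegE (bigD1 i) //= [X in (_ < X)%N](bigD1 i) //= -addSn.
  apply: leq_add; last by apply: leq_sum => j _; apply: le1.
  by apply: leq_trans i2; case: eqP.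
have deg' : (mdeg (m - U_(i))%MM).+1 = k by rewrite -deg_m {2}mE mdegD mdeg1 addn1.
rewrite mE; apply: Pstep; rewrite ?suppB //; first by rewrite inE -lt0n ltnW.
move=> l lJ; apply: IHc; last by rewrite mdegD mdeg1 addn1.
have -> : msupport (m - U_(i) + U_(l))%MM = l |: msupport m.
  apply/setP => j; rewrite -suppB !inE mnmDE mnm1E addn_eq0 negb_and orbC.
  by rewrite [j == l]eq_sym; case: (l == j).
rewrite cardsU1 lJ; lia.
Qed.


(** * Cones, edge vectors and their dual bases *)

Section Cones.
Variables (R : realType) (n : nat).
Implicit Types (A F : set 'rV[R]_n).

Lemma linspan_incl A x : A x -> linspan A x.
Proof.
exists 1%N, x, 1%:M; split; last by rewrite mul1mx.
by move=> i; rewrite row_id ?ord1.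
Qed.

Lemma pair_linspan A u : (forall x, A x -> pair u x = 0) ->
  forall x, linspan A x -> pair u x = 0.
Proof.
move=> uA x [r [g [c [gA ->]]]]; rewrite mulmx_sum_row pair_sumr big1 // => i _.
by rewrite pairZr uA ?mulr0.
Qed.

(** The sum of two supporting functionals cuts out the intersection. *)
Lemma face_ofI F1 F2 A :
  face_of F1 A -> face_of F2 A -> face_of (F1 `&` F2)%classic A.
Proof.
move=> [u1 u1A ->] [u2 u2A ->]; exists (u1 + u2) => [x Ax|].
  by rewrite pairDl addr_ge0 ?u1A ?u2A.
apply/seteqP; split=> x /=; rewrite pairDl.
  by move=> [[Ax ->] [_ ->]]; rewrite addr0.
move=> [Ax /eqP]; rewrite paddr_eq0 ?u1A ?u2A // => /andP[/eqP u1x /eqP u2x].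
by [].
Qed.

Lemma rational_polyhedral_scale A t x :
  rational_polyhedral A -> 0 <= t -> A x -> A (t *: x).
Proof.
move=> [r [g ->]] t0 [c c0 ->]; exists (t *: c); last by rewrite scalemxAl.
by move=> i; rewrite mxE mulr_ge0.
Qed.

Lemma map_intr_inj (F : numDomainType) m :
  injective (map_mx intr : 'rV[int]_m -> 'rV[F]_m).
Proof.
by move=> x y /rowP exy; apply/rowP => i; have := exy i; rewrite !mxE => /intr_inj.
Qed.

End Cones.

Section Sublattices.
Variable n : nat.

Lemma sublattice_sum (L : set 'rV[int]_n) m (c : 'I_m -> int) (x : 'I_m -> 'rV[int]_n) :
  sublattice L -> (forall i, L (x i)) -> L (\sum_i c i *: x i).
Proof.
move=> [L0 LB] Lx.
have LN y : L y -> L (- y) by rewrite -sub0r; apply: LB.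
have LD y z : L y -> L z -> L (y + z) by move=> Ly /LN Lz; rewrite -[z]opprK; apply: LB.
apply: (@big_ind _ L) => // i _.
have LMn (k : nat) : L (k%:Z *: x i).
  by elim: k => [|k IHk]; rewrite ?scale0r // intS scalerDl scale1r; apply: LD.
by case: (c i) => k //; rewrite NegzE scaleNr; apply: LN.
Qed.

Lemma sublattice_ker (F : numFieldType) (u : 'rV[F]_n) :
  primitive_sublattice [set w | pair u (map_mx intr w) = 0]%classic.
Proof.
split=> [|a x a0 /=].
  split=> [|x y /= ux uy]; first by rewrite /= map_mx0 pair0r.
  by rewrite map_mxB pairBr ux uy subrr.
by rewrite map_mxZ pairZr => /eqP; rewrite mulf_eq0 intr_eq0 (negPf a0) => /eqP.
Qed.

End Sublattices.

Section Edges.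
Variables (R : realType) (n : nat) (D : multifan R n).
Variable v : 'I_(nvert D) -> 'rV[int]_n.
Hypothesis v_edge : edge_vectors v.
Notation s := (nvert D).
Implicit Types (I J K : {set 'I_s}).

Lemma simplicesP k I : reflect (I \in complex D /\ #|I| = k) (I \in simplices D k).
Proof. by rewrite inE; apply: (iffP andP) => -[IC /eqP]. Qed.

Lemma cone_set0 x : cone (finset.set0 : {set 'I_s}) x -> x = 0.
Proof.
move=> x0; have [B _ BE] := cone_dimE (complex0 D).
have := linspan_incl x0; rewrite BE /= => /submxP[M ->].
move: B M {BE}; rewrite cards0 => B M.
by rewrite (flatmx0 B) mulmx0.
Qed.

Lemma cone_mono I J1 J2 x : I \in complex D -> J1 \subset J2 -> J2 \subset I ->
  cone J1 x -> cone J2 x.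
Proof.
move=> IC J12 J2I; apply: (cone_order IC (fintype.subset_trans J12 J2I) J2I).1 => //.
Qed.

Lemma edge_in_cone I i : I \in complex D -> i \in I -> cone I (real_of_vec R (v i)).
Proof.
move=> IC iI; apply: (cone_mono IC _ (fintype.subxx _) (v_edge i).2).
by rewrite finset.sub1set.
Qed.

(** Let [u] be a functional that cuts out the face spanned by the vertices of
    [I] other than [i]. If [u] vanished at [v i], this vector would lie in the
    intersection of that face with the ray of [i]. The intersection is a face,
    so it is the cone of a simplex contained in both; this simplex is empty and
    its cone is 0, whereas [v i] is not. *)
Lemma facet_separator I i : I \in complex D -> i \in I ->
  exists u : 'rV[R]_n,
    [/\ forall x, cone I x -> 0 <= pair u x,
        forall J x, J \subset I -> i \notin J -> cone J x -> pair u x = 0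
      & 0 < pair u (real_of_vec R (v i))].
Proof.
move=> IC iI; pose K := I :\ i.
have KI : K \subset I by rewrite finset.subD1set.
have [u uI KE] := cone_face IC KI.
have viI := edge_in_cone IC iI.
exists u; split=> // [J x JI iJ xJ|].
  have /(cone_mono IC) : J \subset K by rewrite finset.subsetD1 JI.
  by move=> /(_ x KI xJ); rewrite KE => -[].
rewrite lt0r uI // andbT; apply/eqP => uvi.
have si : [set i]%SET \subset I by rewrite finset.sub1set.
have [L LI LE] := cone_face_onto IC (face_ofI (cone_face IC KI) (cone_face IC si)).
have LK : L \subset K by apply: (cone_order IC LI KI).2; rewrite -LE => x [].
have Li : L \subset [set i]%SET by apply: (cone_order IC LI si).2; rewrite -LE => x [].
have L0 : L = finset.set0.
  apply/setP => j; rewrite finset.in_set0; apply/negP => jL.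
  have := fintype.subsetP Li j jL; rewrite finset.in_set1 => /eqP ej.
  by have := fintype.subsetP LK j jL; rewrite ej !inE eqxx.
have : cone L (real_of_vec R (v i)).
  by rewrite -LE; split; [rewrite KE|exact: (v_edge i).2].
rewrite L0 => /cone_set0; rewrite -(map_mx0 (intr : {rmorphism int -> R})).
by move=> /map_intr_inj vi0; have := (v_edge i).1; rewrite vi0 eqxx.
Qed.

Definition edge_mx (e : 'I_n -> 'I_s) : 'M[int]_n := \matrix_r v (e r).

Lemma top_enum I : #|I| = n -> exists2 e : 'I_n -> 'I_s,
  injective e & I = [set e r | r : 'I_n]%SET.
Proof.
move=> cI; exists (fun r => enum_val (cast_ord (esym cI) r)).
  by move=> r q /enum_val_inj /cast_ord_inj.
apply/setP => i; apply/idP/imsetP => [iI|[r _ ->]]; last exact: enum_valP.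
exists (cast_ord cI (enum_rank_in iI i)) => //.
by rewrite cast_ordK enum_rankK_in.
Qed.

(** Pairing a linear relation among the edge vectors of [I] with the separator
    of a vertex [i] leaves only the coefficient of [v i]. *)
Lemma det_edge_mx I e : I \in complex D -> injective e -> I
  = [set e r | r : 'I_n]%SET ->
  \det (edge_mx e) != 0.
Proof.
move=> IC e_inj IE.
rewrite -(intr_eq0 R) -det_map_mx; apply/negP => /det0P[c c0 cV].
case/negP: c0; apply/eqP; apply/rowP => r; rewrite [RHS]mxE.
have erI q : e q \in I by rewrite IE; apply/imsetP; exists q.
have [u [uI uJ uv]] := facet_separator IC (erI r).
have : pair u (c *m map_mx intr (edge_mx e)) = 0 by rewrite cV pair0r.
rewrite mulmx_sum_row pair_sumr (bigD1 r) //= big1 ?addr0; last first.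
  move=> q qr; rewrite pairZr -map_row rowK (uJ [set e q]%SET) ?mulr0 //.
  - by rewrite finset.sub1set.
  - by rewrite finset.in_set1 (inj_eq e_inj) eq_sym.
  - exact: (v_edge _).2.
rewrite pairZr -map_row rowK => /eqP; rewrite mulf_eq0 (gt_eqF uv) orbF.
by move/eqP.
Qed.

Lemma pair_edges_inj (F : numFieldType) I (u u' : 'rV[F]_n) : I \in simplices D n ->
  (forall i, i \in I -> pair u (map_mx intr (v i)) = pair u' (map_mx intr (v i))) ->
  u = u'.
Proof.
move=> /simplicesP[IC cI] uu'; have [e e_inj IE] := top_enum cI.
have := det_edge_mx IC e_inj IE.
rewrite -(intr_eq0 F) -det_map_mx -unitfE -unitmxE -unitmx_tr => uV.
apply: (can_inj (mulmxK uV)); apply/rowP => r.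
have /uu' : e r \in I by rewrite IE; apply/imsetP; exists r.
rewrite !pair_mx !mxE => E.
transitivity (\sum_j u 0 j * (map_mx intr (v (e r)))^T j 0).
  by apply: eq_bigr => j _; rewrite !mxE.
by rewrite E; apply: eq_bigr => j _; rewrite !mxE.
Qed.

Lemma dual_vectorP I i j : I \in simplices D n -> i \in I -> j \in I ->
  pair (dual_vector v I i) (rat_of_vec (v j)) = (i == j)%:R.
Proof.
move=> /simplicesP[IC cI] iI; have [e e_inj IE] := top_enum cI.
rewrite /dual_vector; case: xgetP => [u _ /(_ j)//|no].
have := det_edge_mx IC e_inj IE.
rewrite -(intr_eq0 rat) -det_map_mx -unitfE -unitmxE => uV.
move: iI; rewrite {1}IE => /imsetP[r _ iE].
have [] := no (col r (invmx (map_mx intr (edge_mx e))))^T => k.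
rewrite {1}IE => /imsetP[q _ ->]; rewrite pairC pair_mx trmxK.
have <- : row q (map_mx intr (edge_mx e)) = rat_of_vec (v (e q)).
  by rewrite -map_row rowK.
set V := map_mx _ _ in uV *; transitivity ((V *m invmx V) q r).
  by rewrite !mxE; apply: eq_bigr => k' _; rewrite !mxE.
by rewrite mulmxV // mxE iE (inj_eq e_inj) eq_sym.
Qed.

Lemma dual_vector_sum I (u : 'rV[rat]_n) : I \in simplices D n ->
  u = \sum_(i in I) pair u (rat_of_vec (v i)) *: dual_vector v I i.
Proof.
move=> It; apply: (pair_edges_inj It) => j jI.
rewrite pair_suml (bigD1 j) //= big1 ?addr0 => [|i /andP[iI ne]]; rewrite pairZl.
  by rewrite dual_vectorP // eqxx mulr1.
by rewrite dual_vectorP // (negPf ne) mulr0.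
Qed.

Definition real_dual I i : 'rV[R]_n := map_mx ratr (dual_vector v I i).

Lemma pair_ratr (u : 'rV[rat]_n) (w : 'rV[int]_n) :
  pair (map_mx ratr u) (real_of_vec R w) = ratr (pair u (rat_of_vec w)) :> R.
Proof.
rewrite -pair_map /rat_of_vec -map_mx_comp; congr pair; apply/rowP => a.
by rewrite !mxE /= ratr_int.
Qed.

(** The dual vector of [i] is a positive multiple of the separator of [i]. *)
Lemma real_dual_cone I i : I \in simplices D n -> i \in I ->
  (forall x, cone I x -> 0 <= pair (real_dual I i) x) /\
  (forall J x, J \subset I -> i \notin J -> cone J x -> pair (real_dual I i) x = 0).
Proof.
move=> It iI; have /simplicesP[IC _] := It.
have [u [uI uJ uv]] := facet_separator IC iI.
have uE : u = pair u (real_of_vec R (v i)) *: real_dual I i.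
  apply: (pair_edges_inj It) => j jI; rewrite pairZl pair_ratr dual_vectorP //.
  have [<-|ne] := eqVneq i j; first by rewrite rmorph1 mulr1.
  rewrite rmorph0 mulr0 (uJ [set j]%SET) ?finset.sub1set ?finset.in_set1 //.
  exact: (v_edge j).2.
have t0 := gt_eqF uv; move: uE uv t0; set t := pair _ _ => uE t_gt0 t0.
split=> [x xI|J x JI iJ xJ].
  by rewrite -(pmulr_rge0 _ t_gt0) -pairZl -uE uI.
have /eqP := uJ J x JI iJ xJ.
by rewrite uE pairZl mulf_eq0 t0 => /eqP.
Qed.

(** The kernel of the dual vector of [i] is a primitive sublattice, and it
    contains the lattice points of the cone of every face that avoids [i]. *)
Lemma dual_cone_lattice I J i w : I \in simplices D n -> J \subset I -> i \in I ->
  i \notin J -> cone_lattice (D := D) J w ->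
  pair (dual_vector v I i) (rat_of_vec w) = 0.
Proof.
move=> It JI iI iJ hull; apply: (hull _ (sublattice_ker _)) => x /=.
move=> /((real_dual_cone It iI).2 J _ JI iJ) /eqP.
by rewrite pair_ratr fmorph_eq0 => /eqP.
Qed.

Lemma edge_in_lattice J j : J \in complex D -> j \in J ->
  cone_lattice (D := D) J (v j).
Proof. by move=> JC jJ L _; apply; apply: edge_in_cone. Qed.

(** By Cramer's rule, the determinant of the edge vectors times any lattice
    vector is an integral combination of them. *)
Lemma cone_lattice_top I : I \in simplices D n ->
  cone_lattice (D := D) I = [set: 'rV[int]_n]%classic.
Proof.
move=> /simplicesP[IC cI]; have [e e_inj IE] := top_enum cI.
have d0 := det_edge_mx IC e_inj IE.
apply/seteqP; split=> // x _ L [Ls Lp] sL; apply: (Lp _ _ d0).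
have -> : \det (edge_mx e) *: x = \sum_r (x *m \adj (edge_mx e)) 0 r *: v (e r).
  rewrite -mul_mx_scalar -mul_adj_mx mulmxA mulmx_sum_row.
  by apply: eq_bigr => r _; rewrite rowK.
apply: sublattice_sum Ls _ => r; apply: sL; apply: edge_in_cone => //.
by rewrite IE; apply/imsetP; exists r.
Qed.

Lemma edge_index_det I e : I \in simplices D n -> injective e ->
  I = [set e r | r : 'I_n]%SET -> edge_index v I = `|\det (edge_mx e)|%N.
Proof.
move=> It e_inj IE; rewrite /edge_index cone_lattice_top //.
have /simplicesP[IC _] := It.
apply: lattice_index_row_lattice; last exact: det_edge_mx IC e_inj IE.
move=> x; split=> [[c ->]|[c ->]].
  exists (\row_r c (e r)); rewrite mulmx_sum_row IE big_imset /=; last exact: in2W.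
  by apply: eq_bigr => r _; rewrite rowK mxE.
exists (fun i => \sum_(r | e r == i) c 0 r).
rewrite mulmx_sum_row IE big_imset /=; last exact: in2W.
apply: eq_bigr => r _; rewrite rowK (big_pred1 r) // => q.
by rewrite (inj_eq e_inj).
Qed.
End Edges.

(** * Balancing of the weights along a wall *)

Lemma linspan_sum (R : realType) n (A : set 'rV[R]_n) s (J : {set 'I_s}) (a : 'I_s ->
  R) y :
  (forall j, j \in J -> A (y j)) -> linspan A (\sum_(j in J) a j *: y j).
Proof.
move=> yA; exists #|J|, (\matrix_q y (enum_val q)), (\row_q a (enum_val q));
  split=> [q|].
  by rewrite rowK; apply: yA; apply: enum_valP.
by rewrite mulmx_sum_row big_enum_val; apply: eq_bigr => q _; rewrite rowK mxE.
Qed.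

Section RealExpansion.
Variables (R : realType) (n : nat) (D : multifan R n).
Variable v : 'I_(nvert D) -> 'rV[int]_n.
Hypothesis v_edge : edge_vectors v.
Notation s := (nvert D).
Implicit Types (I J K : {set 'I_s}).

Lemma edge_vector_sum I (x : 'rV[R]_n) : I \in simplices D n ->
  x = \sum_(i in I) pair (real_dual v I i) x *: real_of_vec R (v i).
Proof.
move=> It; apply/rowP => a; rewrite -!pair_delta !(pairC _ (delta_mx 0 a)).
set u := delta_mx 0 a.
have {1}-> : u = \sum_(i in I) pair u (real_of_vec R (v i)) *: real_dual v I i.
  apply: (pair_edges_inj v_edge It) => j jI.
  rewrite pair_suml (bigD1 j) //= big1 ?addr0 => [|i /andP[iI ne]];
    rewrite pairZl pair_ratr dual_vectorP //.
    by rewrite eqxx rmorph1 mulr1.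
  by rewrite (negPf ne) rmorph0 mulr0.
rewrite pair_suml pair_sumr; apply: eq_bigr => i _.
by rewrite pairZl pairZr mulrC.
Qed.
End RealExpansion.

Section WallNormal.
Variables (R : realType) (n : nat) (D : multifan R n.+1).
Variable v : 'I_(nvert D) -> 'rV[int]_n.+1.
Hypothesis v_edge : edge_vectors v.
Notation s := (nvert D).
Implicit Types (I J K : {set 'I_s}).

(** The vector [d] represents the linear form that sends [x] to the determinant
    of [x] and the edge vectors of the wall [J]. For a coface [I] = [J] + [i],
    the order of H_I is the absolute value of [d] at [v i], and [d] is a multiple
    of [u_i^I] with factor [d] at [v i]. Hence |H_I| [u_i^I] is [d] or [- d]: up
    to the side of the wall on which [I] lies, it does not depend on [I]. *)
Lemma wall_normal J : #|J| = n -> exists d : 'rV[int]_n.+1,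
  forall i, i |: J \in simplices D n.+1 -> i \notin J ->
    [/\ pair d (v i) != 0, edge_index v (i |: J) = `|pair d (v i)|%N
      & rat_of_vec d = (pair d (v i))%:~R *: dual_vector v (i |: J) i].
Proof.
move=> cJ.
pose eJ (q : 'I_n) : 'I_s := enum_val (cast_ord (esym cJ) q).
have eJ_inj : injective eJ by move=> p q /enum_val_inj /cast_ord_inj.
have eJJ q : eJ q \in J by apply: enum_valP.
have JE : J = [set eJ q | q : 'I_n]%SET.
  apply/eqP; rewrite eq_sym eqEcard; apply/andP; split.
    by apply/fintype.subsetP => j /imsetP[q _ ->].
  by rewrite card_imset // card_ord cJ.
pose VJ : 'M[int]_(n, n.+1) := \matrix_q v (eJ q).
have [d dE dVJ] := det_stack VJ.
have dJ j : j \in J -> pair d (v j) = 0.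
  by rewrite JE => /imsetP[q _ ->]; rewrite -(dVJ q) rowK.
exists d => i It iJ.
pose e (r : 'I_n.+1) : 'I_s := if unlift 0 r is Some q then eJ q else i.
have e0 : e 0 = i by rewrite /e unlift_none.
have el q : e (lift 0 q) = eJ q by rewrite /e liftK.
have e_inj : injective e.
  move=> p q; case: (unliftP 0 p) => [p' ->|->]; case: (unliftP 0 q) => [q' ->|->];
    rewrite ?el ?e0 //.
  - by move=> /eJ_inj ->.
  - by move=> ei; rewrite -ei eJJ in iJ.
  - by move=> ei; rewrite ei eJJ in iJ.
have IE : i |: J = [set e r | r : 'I_n.+1]%SET.
  apply/setP => j; rewrite finset.in_setU1; apply/orP/imsetP => [[/eqP ->|]|[r _ ->]].
  - by exists 0.
  - by rewrite JE => /imsetP[q _ ->]; exists (lift 0 q).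
  - case: (unliftP 0 r) => [q ->|->]; rewrite ?el ?e0; last by left.
    by right.
have eV : edge_mx v e = stack (v i) VJ.
  apply/matrixP => r a; rewrite mxE; case: (unliftP 0 r) => [q ->|->].
    by rewrite el stackSE mxE.
  by rewrite e0 stack0E.
have d0 : pair d (v i) != 0.
  rewrite -dE -eV; apply: (det_edge_mx v_edge _ e_inj IE).
  by case/simplicesP: It.
split=> //; first by rewrite (edge_index_det v_edge It e_inj IE) eV dE.
have iI : i \in i |: J by rewrite finset.setU11.
apply: (pair_edges_inj v_edge It) => j jI.
rewrite pairZl dual_vectorP // -[map_mx _ (v j)]/(rat_of_vec (v j)).
have -> : pair (rat_of_vec d) (rat_of_vec (v j)) = (pair d (v j))%:~R.
  by rewrite -pair_map.
have [<-|ne] := eqVneq i j; first by rewrite mulr1.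
by rewrite mulr0 dJ //; move: jI; rewrite finset.in_setU1 eq_sym (negPf ne).
Qed.

Lemma coface_split J I : #|J| = n -> I \in simplices D n.+1 -> J \subset I ->
  exists2 i, i \notin J & I = i |: J.
Proof.
move=> cJ /simplicesP[_ cI] JI.
have /cards1P[i IJ] : #|I :\: J| == 1%N.
  by rewrite cardsD (finset.setIidPr JI) cI cJ subSnn.
have /finset.setDP[iI iJ] : i \in I :\: J by rewrite IJ finset.set11.
exists i => //; apply/esym/eqP; rewrite eqEcard finset.subUset finset.sub1set iI JI /=.
by rewrite cardsU1 iJ cJ cI.
Qed.

(** Modulo the span of the wall [J], the cone of a coface is the half-line
    through the edge vector of the additional vertex. *)
Lemma proj_cone_wall J i (x : 'rV[R]_n.+1) : i |: J \in simplices D n.+1 ->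
  i \notin J ->
  proj_cone J (i |: J) x <-> 0 <= pair (real_dual v (i |: J) i) x.
Proof.
move=> It iJ; have iI : i \in i |: J by rewrite finset.setU11.
have JI : J \subset i |: J by apply: finset.subsetUr.
have /simplicesP[IC _] := It.
have [uI uJ] := real_dual_cone v_edge It iI.
split=> [[c cI xc]|ux].
  suff /eqP : pair (real_dual v (i |: J) i) (x - c) = 0.
    by rewrite pairBr subr_eq0 => /eqP ->; apply: uI.
  apply: pair_linspan xc => _ [w wJ <-]; rewrite pair_ratr.
  by rewrite (dual_cone_lattice v_edge It JI) // rmorph0.
exists (pair (real_dual v (i |: J) i) x *: real_of_vec R (v i)).
  by apply: rational_polyhedral_scale ux _; [apply: cone_rational|apply: edge_in_cone].
rewrite {1}[x](edge_vector_sum v_edge _ It) finset.big_setU1 //= addrAC subrr add0r.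
apply: linspan_sum => j jJ; exists (v j) => //.
by apply: edge_in_lattice => //; apply: complex_sub IC JI.
Qed.

Hypothesis Dcomplete : complete D.

(** The projected multi-fan of a wall [J] lives in a line, and its maximal cones
    are half-lines. Its degrees at an edge vector [v i0] and at [- v i0]
    are the sums of the weights on the two sides of the wall; they agree because
    this multi-fan is pre-complete. *)
Lemma wall_balance J d : J \in complex D -> #|J| = n ->
  (forall i, i |: J \in simplices D n.+1 -> i \notin J -> pair d (v i) != 0 /\
     rat_of_vec d = (pair d (v i))%:~R *: dual_vector v (i |: J) i) ->
  \sum_(I in simplices D n.+1 | J \subset I)
     weight I * sgz (pair d (\sum_(i in I :\: J) v i)) = 0.
Proof.
move=> JC cJ dP.
have [I0 [I0C cI0 JI0]] := complex_pure JC.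
have I0t : I0 \in simplices D n.+1 by apply/simplicesP.
have [i0 i0J I0E] := coface_split cJ I0t JI0.
rewrite {}I0E {I0C cI0} in I0t JI0.
have [d0 _] := dP i0 I0t i0J.
pose dR : 'rV[R]_n.+1 := real_of_vec R d.
have dRE i : i |: J \in simplices D n.+1 -> i \notin J ->
    dR = (pair d (v i))%:~R *: real_dual v (i |: J) i.
  move=> It iJ; have [_ /(congr1 (map_mx (ratr : rat -> R)))] := dP i It iJ.
  rewrite map_mxZ /= ratr_int -/(real_dual _ _ _) => <-.
  by rewrite -map_mx_comp; apply/rowP => a; rewrite !mxE /= ratr_int.
have dRv w : pair dR (real_of_vec R w) = (pair d w)%:~R.
  by rewrite -pair_map.
(* The only simplex of less than maximal dimension in the projected multi-fan is
   [J] itself, and [d] vanishes on the span of its cone. *)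
have gen (x : 'rV[R]_n.+1) : pair dR x != 0 -> proj_generic J x.
  move=> dx K KC JK cK; have -> : K = J.
    by apply/esym/eqP; rewrite eqEcard JK cJ -ltnS.
  apply: contra_notP (elimN eqP dx) => /contrapT; apply: pair_linspan => y [c cJc yc].
  have iI : i0 \in i0 |: J by rewrite finset.setU11.
  rewrite -[y](subrK c) pairDr (dRE _ I0t i0J) !pairZl.
  rewrite (pair_linspan _ yc) => [|_ [w wJ <-]]; last first.
    by rewrite pair_ratr (dual_cone_lattice v_edge I0t JI0) // rmorph0.
  by rewrite ((real_dual_cone v_edge I0t iI).2 J c JI0 i0J cJc) mulr0 addr0.
pose sg I := sgz (pair d (\sum_(i in I :\: J) v i)).
have sgE i : i \notin J -> sg (i |: J) = sgz (pair d (v i)).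
  move=> iJ; rewrite /sg (_ : _ :\: _ = [set i]%SET) ?big_set1 //.
  by apply/setP => j; rewrite !inE; case: eqVneq => [->|_]; rewrite ?iJ //= andNb.
have projE (x : 'rV[R]_n.+1) I : I \in simplices D n.+1 -> J \subset I ->
    pair dR x != 0 ->
  `[< proj_cone J I x >] = (sg I == sgz (pair dR x)).
  move=> It JI dx; have [i iJ IE] := coface_split cJ It JI; rewrite IE sgE // in It *.
  have [di _] := dP i It iJ.
  have : sgz (pair dR x) = sgz (pair d (v i)) * sgz (pair (real_dual v (i |: J) i) x).
    by rewrite {1}(dRE i It iJ) pairZl sgzM sgz_int.
  have t0 : pair (real_dual v (i |: J) i) x != 0.
    by apply: contra dx => /eqP ux; rewrite (dRE i It iJ) pairZl ux mulr0.
  move: (proj_cone_wall x It iJ) t0; set t := pair (real_dual _ _ _) x => tP t0 ->.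
  have a0 : sgz (pair d (v i)) != 0 by rewrite sgz_eq0.
  rewrite -[X in X == _]mulr1 (inj_eq (mulfI a0)) eq_sym.
  apply/asboolP/idP => [/tP tge|/eqP sgt]; last first.
    by apply/tP; rewrite -sgz_ge0 sgt.
  by rewrite gtr0_sgz // lt0r t0.
have degE (x : 'rV[R]_n.+1) : pair dR x != 0 ->
    proj_degree J x = \sum_(I in simplices D n.+1 |
      (J \subset I) && (sg I == sgz (pair dR x))) weight I.
  move=> dx; apply: eq_bigl => I.
  by have [It|//] := boolP (I \in _); have [JI|//] := boolP (J \subset I);
    rewrite projE.
pose x0 := real_of_vec R (v i0); pose s0 := sgz (pair d (v i0)).
have sx0 : sgz (pair dR x0) = s0 by rewrite dRv sgz_int.
have sNx0 : sgz (pair dR (- x0)) = - s0 by rewrite -scaleN1r pairZr mulN1r sgzN sx0.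
have dx0 : pair dR x0 != 0 by rewrite dRv intr_eq0.
have dNx0 : pair dR (- x0) != 0 by rewrite -scaleN1r pairZr mulN1r oppr_eq0.
have := Dcomplete JC (gen _ dx0) (gen _ dNx0); rewrite !degE // sx0 sNx0.
have s00 : s0 != 0 by rewrite sgz_eq0.
have sgv I : I \in simplices D n.+1 -> J \subset I -> sg I = s0 \/ sg I = - s0.
  move=> It JI; have [i iJ IE] := coface_split cJ It JI; rewrite IE sgE // in It *.
  have [di _] := dP i It iJ; rewrite /s0.
  by case: sgzP di => //; case: sgzP d0 => //; auto.
move=> eqdeg.
rewrite (bigID (fun I => sg I == s0)) /=.
rewrite [X in X + _](_ : _ = s0
  * \sum_(I in simplices D n.+1 | (J \subset I) && (sg I == s0)) weight I).
  rewrite [X in _ + X](_ : _ = - s0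
    * \sum_(I in simplices D n.+1 | (J \subset I) && (sg I == - s0)) weight I).
    by rewrite eqdeg mulNr subrr.
  rewrite mulr_sumr; apply: eq_big => [I|I /andP[/andP[It JI] sI]].
    have ns : (s0 == - s0) = false by apply/negP => /eqP; move/eqP: s00; lia.
    rewrite -andbA; have [It|//] := boolP (I \in _);
      have [JI|//] := boolP (J \subset I).
    by have [->|->] := sgv I It JI; rewrite ?eqxx ?ns // eq_sym ns.
  by have [/eqP|] := sgv I It JI; rewrite ?(negPf sI) // -/(sg I) => ->; rewrite mulrC.
rewrite mulr_sumr; apply: eq_big => [I|I /andP[_ /eqP sI]]; first by rewrite andbA.
by rewrite -/(sg I) sI mulrC.
Qed.

End WallNormal.

(** * Homogeneous polynomials and linear forms *)

Section Homogeneous.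
Variable N : nat.
Implicit Types (P Q : {mpoly rat[N]}).

Lemma dhomog_bigprod (I : Type) (r : seq I) (A : pred I) (F : I ->
  {mpoly rat[N]}) (d : I -> nat) :
  (forall i, A i -> F i \is (d i).-homog) ->
  \prod_(i <- r | A i) F i \is (\sum_(i <- r | A i) d i)%N.-homog.
Proof.
move=> Fd; apply: (@big_ind2 _ _ (fun (p : {mpoly rat[N]}) d => p \is d.-homog)) => //.
  exact: dhomog1.
by move=> p d1 q d2; apply: dhomogM.
Qed.

Lemma mmap_dhomog M (h : 'I_M -> {mpoly rat[N]}) p d :
  (forall i, h i \is 1.-homog) -> p \is d.-homog ->
  mmap (@mpolyC N rat) h p \is d.-homog.
Proof.
move=> h1 /dhomogP pd; rewrite /mmap big_seq; apply: rpred_sum => m /pd md.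
have {md}<- : mdeg m = d by [].
rewrite mul_mpolyC dhomogZ // /mmap1 mdegE; apply: dhomog_bigprod => i _.
by rewrite -[X in X.-homog]mul1n; apply: dhomogMn.
Qed.

(** In degree [d], the product [P * Q] is [P@_0] times [Q] and [S] has no part. *)
Lemma homog_quotient_coef0 P Q S d e : P * Q = S -> Q != 0 ->
  Q \is d.-homog -> S \is e.-homog -> e != d -> P@_0%MM = 0.
Proof.
move=> PQS Q0 Qd Se ne; pose G := pihomog mdeg 0 P.
have [k kP] : exists k, (msize P <= k)%N by exists (msize P).
have PE := pihomog_partitionE kP.
have GQ : pihomog mdeg d (P * Q) = pihomog mdeg d (G * Q).
  rewrite {1}PE mulr_suml raddf_sum /=.
  have [k0|k_gt0] := posnP k.
    by move: kP; rewrite k0 leqn0 msize_poly_eq0 => /eqP P0;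
      rewrite /G P0 big_ord0 raddf0 mul0r raddf0.
  rewrite (bigD1 (Ordinal k_gt0)) //= big1 ?addr0 // => i i0.
  apply: (@pihomog_ne0 _ _ _ (i + d)%N); last exact: dhomogM (pihomogP _ _ _) Qd.
  by rewrite -[X in _ != X]add0n eqn_add2r; apply: contra i0 => /eqP i0;
    apply/eqP/val_inj.
move: GQ; rewrite PQS (pihomog_ne0 ne Se) pihomog_dE; last first.
  by rewrite -[d]add0n; apply: dhomogM => //; apply: pihomogP.
move/esym/eqP; rewrite mulf_eq0 (negPf Q0) orbF => /eqP G0.
rewrite PE raddf_sum /= big1 // => i _; have [i0|i0] := eqVneq (i : nat) 0%N.
  by rewrite i0 -/G G0 mcoeff0.
by apply: (dhomog_nemf_coeff (pihomogP _ _ _)); rewrite /= mdeg0 eq_sym.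
Qed.

End Homogeneous.

Section LinearForm.
Variable N : nat.
Implicit Types (a b : 'rV[rat]_N).

Lemma linear_form_is_linear : linear (@linear_form N).
Proof.
move=> c a b; rewrite /linear_form scaler_sumr -big_split; apply: eq_bigr => i _ /=.
by rewrite !mxE scalerDl scalerA.
Qed.
HB.instance Definition _ := GRing.isLinear.Build rat 'rV[rat]_N {mpoly rat[N]} _
  (@linear_form N) linear_form_is_linear.

Lemma linear_form_coef a i : (linear_form a)@_U_(i)%MM = a 0 i.
Proof.
rewrite /linear_form raddf_sum /= (bigD1 i) //= big1 ?addr0 => [|j ne].
  by rewrite mcoeffZ mcoeffX eqxx mulr1.
by rewrite mcoeffZ mcoeffX eq_mnm1 (negPf ne) mulr0.
Qed.

Lemma linear_form_eq0 a : (linear_form a == 0) = (a == 0).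
Proof.
apply/eqP/eqP => [a0|->]; last exact: linear0.
by apply/rowP => i; rewrite -linear_form_coef a0 mcoeff0 mxE.
Qed.

Lemma linear_form_homog a : linear_form a \is 1.-homog.
Proof. by apply: rpred_sum => i _; rewrite dhomogZ // dhomogX /= mdeg1. Qed.

End LinearForm.

(** * The push-forward in degrees n - 1 and n *)

Section PushForward.
Variables (R : realType) (n : nat) (D : multifan R n).
Variable v : 'I_(nvert D) -> 'rV[int]_n.
Hypothesis v_edge : edge_vectors v.
Notation s := (nvert D).
Implicit Types (I J K : {set 'I_s}) (p q : {mpoly rat[s]}) (m : 'X_{1..s}).

Definition iota_poly I : {mpoly rat[s]} -> {mpoly rat[n]} :=
  mmap (@mpolyC n rat) (fun i => linear_form (iota_vertex v I i)).
HB.instance Definition _ I := GRing.RMorphism.on (iota_poly I).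

Variables (F : fieldType) (phi : {rmorphism {mpoly rat[n]} -> F}).

Definition push_coef I : F :=
  (weight I)%:~R / ((edge_index v I)%:R
       * phi (\prod_(i in I) linear_form (dual_vector v I i))).

(** pi_* on representatives in the polynomial ring, with values in a field [F]
    to which Sym(M_Q) is mapped by [phi]. *)
Definition push_poly p : F := \sum_(I in simplices D n) push_coef I
  * phi (iota_poly I p).

Definition const_image (c : rat) : F := phi c%:MP.
HB.instance Definition _ := GRing.RMorphism.copy const_image (phi \o @mpolyC n rat).

Lemma push_poly_sum (T : Type) (r : seq T) (A : pred T) (c : T -> rat) (p : T ->
  {mpoly rat[s]}) :
  push_poly (\sum_(t <- r | A t) c t *: p t)
  = \sum_(t <- r | A t) const_image (c t) * push_poly (p t).
Proof.
under [RHS]eq_bigr => t _ do rewrite mulr_sumr.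
rewrite exchange_big; apply: eq_bigr => I _ /=.
rewrite [iota_poly I _](rmorph_sum (iota_poly I)) (rmorph_sum phi) mulr_sumr.
apply: eq_bigr => t _ /=.
by rewrite /iota_poly mmapZ rmorphM /= mulrCA.
Qed.

(** Representative of the class by which [u] acts on the face ring. *)
Definition act_poly (u : 'rV[rat]_n) : {mpoly rat[s]} :=
  \sum_l pair u (rat_of_vec (v l)) *: 'X_l.

Lemma iota_act I u : I \in simplices D n -> iota_poly I (act_poly u) = linear_form u.
Proof.
move=> It; rewrite (rmorph_sum (iota_poly I)) [in RHS](dual_vector_sum v_edge u It)
  linear_sum.
rewrite [RHS]big_mkcond /=.
apply: eq_bigr => l _; rewrite /iota_poly mmapZ mmapX mmap1U mul_mpolyC /iota_vertex.
by case: ifP => _; rewrite ?linearZ //= linear0 scaler0.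
Qed.

(** Expanding [u] in the basis dual to the edge vectors of [I] shows that
    iota_I^* sends the class of [u] to [u]; so pi_* is Sym(M)-linear. *)
Lemma push_poly_act u p : push_poly (act_poly u * p)
  = phi (linear_form u) * push_poly p.
Proof.
rewrite mulr_sumr; apply: eq_bigr => I It.
by rewrite rmorphM /= rmorphM /= iota_act // mulrCA.
Qed.

Lemma actX u m : act_poly u * 'X_[m]
  = \sum_l pair u (rat_of_vec (v l)) *: 'X_[m + U_(l)].
Proof.
by rewrite mulr_suml; apply: eq_bigr => l _; rewrite -scalerAl addmC mpolyXD.
Qed.

Lemma iota_monomial I m : iota_poly I 'X_[m]
  = \prod_i linear_form (iota_vertex v I i) ^+ m i.
Proof. by rewrite /iota_poly mmapX. Qed.

Lemma iota_monomial_eq0 I m : ~~ (msupport m \subset I) -> iota_poly I 'X_[m] = 0.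
Proof.
case/subsetPn => i; rewrite inE => mi iI; rewrite iota_monomial (bigD1 i) //=.
by rewrite /iota_vertex (negPf iI) linear0 expr0n (negPf mi) mul0r.
Qed.

Lemma msupport_mesym1 J : msupport (mesym1 J) = J.
Proof. by apply/setP => i; rewrite inE mnmE eqb0 negbK. Qed.

Lemma iota_mesym1 I J : J \subset I ->
  iota_poly I 'X_[mesym1 J] = \prod_(j in J) linear_form (dual_vector v I j).
Proof.
move=> JI; rewrite iota_monomial [RHS]big_mkcond; apply: eq_bigr => i _.
rewrite mnmE /iota_vertex; have [iJ|iJ] := boolP (i \in J); last by rewrite expr0.
by rewrite (fintype.subsetP JI) // expr1.
Qed.

Lemma push_nonface r m : msupport m \notin complex D -> push_poly (r * 'X_[m]) = 0.
Proof.
move=> mC; rewrite /push_poly big1 // => I /simplicesP[IC _].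
have iX : iota_poly I 'X_[m] = 0 by apply: iota_monomial_eq0; apply: contra mC;
  apply: complex_sub IC.
by rewrite (rmorphM (iota_poly I)) /= iX mulr0 rmorph0 mulr0.
Qed.

Lemma dual_vector_neq0 I i : I \in simplices D n -> i \in I -> dual_vector v I i != 0.
Proof.
move=> It iI; apply/eqP => u0; have := dual_vectorP v_edge It iI iI.
by rewrite u0 pair0l eqxx => /eqP; rewrite eq_sym oner_eq0.
Qed.

Lemma edge_index_neq0 I : I \in simplices D n -> edge_index v I != 0%N.
Proof.
move=> It; have /simplicesP[IC cI] := It; have [e e_inj IE] := top_enum cI.
by rewrite (edge_index_det v_edge It e_inj IE) absz_eq0 (det_edge_mx v_edge IC e_inj
  IE).
Qed.

End PushForward.

(** Only the cofaces [I] = [J] + [i] of the wall contribute. In their terms the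
    factors [u_j^I], [j] in [J], cancel, and w(I) / (|H_I| [u_i^I]) remains. By
    [wall_normal] this is w(I) / [d] up to the sign of [d] at [v i], so that the
    sum vanishes by [wall_balance]. *)
Lemma push_wall_succ (R : realType) n (D : multifan R n.+1) (Dcomplete : complete D)
    (v : 'I_(nvert D) -> 'rV[int]_n.+1) (v_edge : edge_vectors v)
    (F : fieldType) (phi : {rmorphism {mpoly rat[n.+1]} -> F})
    (phi_eq0 : forall p, (phi p == 0) = (p == 0)) (J : {set 'I_(nvert D)}) :
  J \in complex D -> #|J| = n -> push_poly v phi 'X_[mesym1 J] = 0.
Proof.
move=> JC cJ; have [d dP] := wall_normal v_edge cJ.
have bal : \sum_(I in simplices D n.+1 | J \subset I)
     weight I * sgz (pair d (\sum_(i in I :\: J) v i)) = 0.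
  apply: wall_balance => // i It iJ.
  by have [d0 _ dE] := dP i It iJ.
pose Ld : F := phi (linear_form (rat_of_vec d)).
rewrite /push_poly (bigID (fun I : {set _} =>
  J \subset I)) /= [X in _ + X]big1 ?addr0; last first.
  by move=> I /andP[_ JI]; rewrite iota_monomial_eq0 ?msupport_mesym1 // rmorph0 mulr0.
transitivity ((\sum_(I in simplices D n.+1 | J \subset I)
     weight I * sgz (pair d (\sum_(i in I :\: J) v i)))%:~R / Ld);
       last by rewrite bal mul0r.
rewrite rmorph_sum mulr_suml; apply: eq_bigr => I /andP[It JI] /=.
rewrite iota_mesym1 //; have [i iJ IE] := coface_split cJ It JI;
  rewrite {}IE in It JI *.
have -> : (i |: J) :\: J = [set i]%SET.
  by apply/setP => j; rewrite !inE; case: eqVneq => [->|_]; rewrite ?iJ //= andNb.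
rewrite big_set1; have [d0 iE dE] := dP i It iJ.
have Lu j : j \in i |: J -> linear_form (dual_vector v (i |: J) j) != 0.
  by move=> jI; rewrite linear_form_eq0 dual_vector_neq0.
set u := dual_vector v (i |: J) i in dE *.
have u0 : phi (linear_form u) != 0 by rewrite phi_eq0 Lu // finset.setU11.
have PJ0 : phi (\prod_(j in J) linear_form (dual_vector v (i |: J) j)) != 0.
  rewrite phi_eq0; apply/prodf_neq0 => j jJ; apply: Lu.
  by rewrite finset.in_setU1 jJ orbT.
rewrite /push_coef finset.big_setU1 //= -/u iE rmorphM.
have -> : Ld = (pair d (v i))%:~R * phi (linear_form u).
  by rewrite /Ld dE linearZ /= -mul_mpolyC rmorphM /= !rmorph_int.
rewrite intrM; set c := pair d (v i) in d0 *.
have c0 : c%:~R != 0 :> F.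
  by rewrite -(rmorph_int (const_image phi)) fmorph_eq0 intr_eq0.
have -> : `|c|%N%:R = (sgz c)%:~R * c%:~R :> F by rewrite -intrM -abszEsg.
have : (sgz c)%:~R * (sgz c)%:~R = 1 :> F by rewrite -intrM mulz_sg d0.
move: (sgz c)%:~R => g gg; have g0 : g != 0.
  by apply/eqP => g0; move/eqP: gg; rewrite g0 mul0r eq_sym oner_eq0.
rewrite -[in RHS](mulfK g0 g) gg mul1r; field.
by rewrite c0 g0 u0 PJ0.
Qed.

Lemma push_wall (R : realType) n (D : multifan R n) (v : 'I_(nvert D) -> 'rV[int]_n)
    (F : fieldType) (phi : {rmorphism {mpoly rat[n]} -> F}) (J : {set 'I_(nvert D)}) :
  (forall p, (phi p == 0) = (p == 0)) ->
  complete D -> edge_vectors v -> J \in complex D -> #|J|.+1 = n ->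
  push_poly v phi 'X_[mesym1 J] = 0.
Proof.
by case: n D v phi J => // n D v phi J p0 Dc ve JC [cJ]; apply: push_wall_succ.
Qed.

Section Vanishing.
Variables (R : realType) (n : nat) (D : multifan R n).
Hypothesis Dcomplete : complete D.
Variable v : 'I_(nvert D) -> 'rV[int]_n.
Hypothesis v_edge : edge_vectors v.
Variables (F : fieldType) (phi : {rmorphism {mpoly rat[n]} -> F}).
Hypothesis phi_eq0 : forall p, (phi p == 0) = (p == 0).
Notation s := (nvert D).
Implicit Types (I J K : {set 'I_s}) (p q : {mpoly rat[s]}) (m : 'X_{1..s}).

Lemma push_act_expand u m :
  phi (linear_form u) * push_poly v phi 'X_[m]
  = \sum_l const_image phi (pair u (rat_of_vec (v l))) * push_poly v phi 'X_[m + U_(l)].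
Proof. by rewrite -push_poly_act // actX push_poly_sum. Qed.

(** The relation given by [u], solved for the term of the vertex [i]. *)
Lemma push_act_isolate I u m i : i \in msupport m ->
  pair u (rat_of_vec (v i)) = 1 ->
  (forall j, j \in msupport m -> j != i -> pair u (rat_of_vec (v j)) = 0) ->
  push_poly v phi 'X_[m + U_(i)] = phi (linear_form u) * push_poly v phi 'X_[m]
   - \sum_(l | l \notin msupport m) const_image phi (pair u (rat_of_vec (v l)))
     * push_poly v phi 'X_[m + U_(l)].
Proof.
move=> im ui uj; rewrite push_act_expand (bigID (mem (msupport m))) /= addrK.
rewrite (bigD1 i) //= ui rmorph1 mul1r big1 ?addr0 // => j /andP[jm ji].
by rewrite uj // rmorph0 mul0r.
Qed.

(** Exchange argument in degree [n - 1], where the squarefree monomials are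
    settled by the walls. Let [m'] have degree [n - 2] and support in a simplex
    [I] with [n] vertices, and let [p] be a vertex of [I] that does not occur in
    [m']. If pi_* vanishes on all monomials [m' + U_(l)] with [l] off the
    support, the relation of [u_p^I] reads [u_p^I] * pi_*(x^m') = 0. With
    pi_*(x^m') = 0, the relation of [u_i^I] gives the claim for [m' + U_(i)]. *)
Lemma push_monomial_vanish m : (mdeg m).+1 = n -> push_poly v phi 'X_[m] = 0.
Proof.
move=> mn; have [nE {mn}] : n.-1.+1 = n /\ mdeg m = n.-1 by lia.
move: m; apply: (@face_monomial_ind _ (complex D) n.-1 (fun m =>
  push_poly v phi 'X_[m] = 0)).
- by move=> m _ mC; rewrite -['X_[m]]mul1r push_nonface.
- move=> J JC cJ; by apply: push_wall => //; rewrite cJ.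
- move=> m i mC cm im mk Pl.
  have [I [IC cI mI]] := complex_pure mC.
  have It : I \in simplices D n by apply/simplicesP.
  have [p pI pm] : exists2 p, p \in I & p \notin msupport m.
    apply/subsetPn; apply/negP => /subset_leq_card; rewrite cI leqNgt => /negP; apply.
    by apply: leq_trans cm _; apply: leq_pred.
  have iI := fintype.subsetP mI i im.
  have m0 : push_poly v phi 'X_[m] = 0.
    have /eqP : phi (linear_form (dual_vector v I p)) * push_poly v phi 'X_[m] = 0.
      rewrite push_act_expand big1 // => l _.
      have [lm|/Pl ->] := boolP (l \in msupport m); last by rewrite mulr0.
      rewrite dual_vectorP ?(fintype.subsetP mI l) //.
      have -> : (p == l) = false by apply: contraNF pm => /eqP ->.
      by rewrite rmorph0 mul0r.
    by rewrite mulf_eq0 phi_eq0 linear_form_eq0 (negPf (dual_vector_neq0 v_edge It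
      pI)) => /eqP.
  rewrite (@push_act_isolate I (dual_vector v I i)) ?m0 ?mulr0 ?sub0r ?dual_vectorP
    ?eqxx //.
    by rewrite big1 ?oppr0 // => l lm; rewrite Pl // mulr0.
  by move=> j jm ji; rewrite dual_vectorP ?(fintype.subsetP mI j) // eq_sym (negPf ji).
Qed.

(** Exchange argument in degree [n]: the products of the [u_j^I] cancel in
    pi_*(x_I), and the relation of [u_i^I] has no term pi_*(x^m) because this is
    the image of a monomial of degree [n - 1]. *)
Lemma push_monomial_const m : mdeg m = n ->
  exists c, push_poly v phi 'X_[m] = const_image phi c.
Proof.
move: m; apply: (@face_monomial_ind _ (complex D) n (fun m =>
  exists c, push_poly v phi 'X_[m] = const_image phi c)).
- move=> m _ mC; by exists 0; rewrite -['X_[m]]mul1r push_nonface // rmorph0.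
- move=> J JC cJ; have Jt : J \in simplices D n by apply/simplicesP.
  exists ((weight J)%:~R / (edge_index v J)%:R).
  rewrite /push_poly (bigD1 J) //= big1 ?addr0; last first.
    move=> I /andP[It IJ]; rewrite iota_monomial_eq0 ?rmorph0 ?mulr0 // msupport_mesym1.
    apply: contra IJ => JI; rewrite eq_sym eqEcard JI cJ.
    by have /simplicesP[_ cI] := It; rewrite cI leqnn.
  rewrite iota_mesym1 // /push_coef invfM mulrA mulfVK.
    by rewrite rmorphM fmorphV rmorph_int rmorph_nat.
  rewrite phi_eq0; apply/prodf_neq0 => j jJ.
  by rewrite linear_form_eq0 dual_vector_neq0.
- move=> m i mC cm im mk Pl.
  have [I [IC cI mI]] := complex_pure mC.
  have It : I \in simplices D n by apply/simplicesP.
  have iI := fintype.subsetP mI i im.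
  rewrite (@push_act_isolate I (dual_vector v I i)) ?dual_vectorP ?eqxx //; last first.
    by move=> j jm ji; rewrite dual_vectorP ?(fintype.subsetP mI j) //
      eq_sym (negPf ji).
  rewrite push_monomial_vanish // mulr0 sub0r.
  have [c cE] : exists c, \sum_(l | l \notin msupport m)
      const_image phi (pair (dual_vector v I i) (rat_of_vec (v l)))
        * push_poly v phi 'X_[m + U_(l)] = const_image phi c.
    apply: (big_ind (fun x => exists c, x = const_image phi c)).
    + by exists 0; rewrite rmorph0.
    + by move=> _ _ [c ->] [c' ->]; exists (c + c'); rewrite rmorphD.
    + by move=> l lm; have [c ->] := Pl l lm;
      exists (pair (dual_vector v I i) (rat_of_vec (v l)) * c); rewrite rmorphM.
  by exists (- c); rewrite rmorphN cE.
Qed.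

Lemma push_poly_sum_monomials p : push_poly v phi p
  = \sum_(m <- msupp p) const_image phi p@_m * push_poly v phi 'X_[m].
Proof. by rewrite -push_poly_sum // -mpolyE. Qed.

Lemma push_homog_vanish p d : p \is d.-homog -> d.+1 = n -> push_poly v phi p = 0.
Proof.
move=> /dhomogP pd dn; rewrite push_poly_sum_monomials big_seq big1 // => m /pd md.
by rewrite push_monomial_vanish ?mulr0 // -[RHS]dn; congr _.+1.
Qed.

Lemma push_homog_const p : p \is n.-homog -> exists c, push_poly v phi p
  = const_image phi c.
Proof.
move=> /dhomogP pn.
rewrite push_poly_sum_monomials big_seq;
  apply: (big_ind (fun x => exists c, x = const_image phi c)).
- by exists 0; rewrite rmorph0.
- by move=> _ _ [c ->] [c' ->]; exists (c + c'); rewrite rmorphD.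
- by move=> m /pn /push_monomial_const[c ->]; exists (p@_m * c); rewrite rmorphM.
Qed.

Lemma push_poly_fraction p d : p \is d.-homog -> exists e (Q S : {mpoly rat[n]}),
  [/\ Q != 0, phi Q * push_poly v phi p
    = phi S, Q \is (e + n).-homog & S \is (e + d).-homog].
Proof.
move=> pd.
pose Q I : {mpoly rat[n]} := (edge_index v I)%:R
  * \prod_(i in I) linear_form (dual_vector v I i).
have Qn I : I \in simplices D n -> Q I \is n.-homog.
  move=> /simplicesP[_ cI]; rewrite /Q mulr_natl rpredMn //.
  suff: \prod_(i in I) linear_form (dual_vector v I i) \is (\sum_(i in I) 1)%N.-homog.
    by rewrite sum1_card cI.
  by apply: dhomog_bigprod => i _; exact: linear_form_homog.
have Q0 I : I \in simplices D n -> Q I != 0.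
  move=> It; rewrite mulf_neq0 //.
    rewrite -(rmorph_nat (@mpolyC n rat)) mpolyC_eq0 pnatr_eq0.
    exact: edge_index_neq0.
  by apply/prodf_neq0 => i iI; rewrite linear_form_eq0 dual_vector_neq0.
pose c := #|simplices D n|.
have c_gt0 : (0 < c)%N.
  have [I [IC cI _]] := complex_pure (complex0 D).
  by apply/card_gt0P; exists I; apply/simplicesP.
exists (c.-1 * n)%N, (\prod_(I in simplices D n) Q I), (\sum_(I in simplices D n)
  (weight I)%:~R * iota_poly v I p * \prod_(I' in simplices D n | I' != I) Q I').
split.
- exact/prodf_neq0.
- rewrite mulr_sumr rmorph_sum; apply: eq_bigr => I It.
  rewrite (bigD1 I) //= !rmorphM /= rmorph_int /push_coef -(rmorph_nat phi) -rmorphM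
    -/(Q I).
  by field; rewrite phi_eq0 Q0.
- rewrite -mulSnr prednK // -sum_nat_const; exact: dhomog_bigprod.
- apply: rpred_sum => I It; rewrite addnC; apply: dhomogM.
    rewrite mulrzl rpredMz //; apply: mmap_dhomog pd => i; exact: linear_form_homog.
  rewrite (_ : (c.-1 * n)%N = \sum_(I' in simplices D n | I' != I) n)%N.
    by apply: dhomog_bigprod => I' /andP[/Qn].
  have := sum_nat_const (mem (simplices D n)) n.
  rewrite (bigD1 I) //= -[#|_|]/c -(prednK c_gt0) mulSn => /eqP.
  by rewrite eqn_add2l => /eqP <-.
Qed.
End Vanishing.

Section PushP.
Variables (R : realType) (n : nat) (D : multifan R n).
Hypothesis Dcomplete : complete D.
Variable v : 'I_(nvert D) -> 'rV[int]_n.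
Hypothesis v_edge : edge_vectors v.
Notation frac := (@tofrac {mpoly rat[n]}).

Lemma push_piE p : push_pi v (face_class D p) = push_poly v frac p.
Proof.
apply: eq_bigr => I /simplicesP[IC _].
by rewrite iota_star_class // mulrAC.
Qed.

Lemma push_p_homog p : p \is n.-homog -> push_poly v frac p
  = const_image frac (push_p v (face_class D p)).
Proof.
move=> pn; have [c pc] := push_homog_const Dcomplete v_edge (@tofrac_eq0 _) pn.
rewrite pc /push_p; congr (const_image _ _).
case: xgetP => [P _ /= PE|/(_ c%:MP) []]; last by rewrite /= push_piE pc.
have /eqP : tofrac P = tofrac c%:MP by rewrite PE push_piE.
by rewrite tofrac_eq => /eqP ->; rewrite mcoeffC eqxx mulr1.
Qed.

(** pi_* shifts the polynomial degree by [- n], so it produces a constant term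
    only in degree [n]. *)
Lemma push_p_homog_neq p d : p \is d.-homog -> d != n -> push_p v (face_class D p) = 0.
Proof.
move=> pd dn; rewrite /push_p; case: xgetP => [P _ /= PE|_]; last exact: mcoeff0.
have [e [Q [S [Q0 QS Qn Sd]]]] := push_poly_fraction v_edge (@tofrac_eq0 _) pd.
apply: (homog_quotient_coef0 _ Q0 Qn Sd); last by rewrite eqn_add2l.
by apply/eqP; rewrite -tofrac_eq rmorphM /= PE push_piE mulrC QS.
Qed.
End PushP.

(** * Evaluation at a plane *)

Lemma rat_row_scale m (u : 'rV[rat]_m) :
  exists2 N : int, N != 0 & exists w : 'rV[int]_m, N%:~R *: u = map_mx intr w.
Proof.
exists (\prod_a denq (u 0 a)); first by apply/prodf_neq0 => a _; apply: denq_neq0.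
exists (\row_a (numq (u 0 a) * \prod_(b | b != a) denq (u 0 b))).
apply/rowP => a; rewrite !mxE (bigD1 a) //= !intrM mulrAC; congr (_ * _).
by rewrite mulrC -{1}[u 0 a]divq_num_den divfK // intr_eq0 denq_neq0.
Qed.

Section LatticeBasis.
Variables (R : realType) (n : nat) (D : multifan R n).
Variable v : 'I_(nvert D) -> 'rV[int]_n.
Hypothesis v_edge : edge_vectors v.
Notation s := (nvert D).
Implicit Types (I J K : {set 'I_s}).
Variables (r : nat) (B : 'M[int]_(r, n)).

Notation BQ := (map_mx intr B : 'M[rat]_(r, n)).

Lemma basis_row_free L : lattice_basis B L -> row_free BQ.
Proof.
move=> [_ Binj]; apply/inj_row_free => c cB.
have [N N0 [w wE]] := rat_row_scale c.
have : w *m B = 0.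
  apply: (@map_intr_inj rat); rewrite map_mxM -wE -scalemxAl cB scaler0.
  by rewrite map_mx0.
move=> /Binj w0; move/eqP: wE; rewrite w0 map_mx0 scaler_eq0 intr_eq0 (negPf N0).
by move=> /eqP.
Qed.

Lemma basis_kills_edges J j : lattice_basis B (annihilator J) -> J \in complex D ->
  j \in J -> BQ *m (rat_of_vec (v j))^T = 0.
Proof.
move=> [BE _] JC jJ; apply/colP => q; rewrite [RHS]mxE.
have : annihilator J (row q B) by apply/BE; exists (delta_mx 0 q); rewrite rowE.
move=> /(_ (v j) (edge_in_lattice v_edge JC jJ)) e0.
transitivity ((pair (row q B) (v j))%:~R : rat); last by rewrite e0.
by rewrite -pair_map !mxE; apply: eq_bigr => a _; rewrite !mxE.
Qed.

(** A form that vanishes on the edge vectors of [J] is a combination of the dual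
    vectors of the vertices of [I] outside [J], which vanish on N_J; a multiple
    of it is integral, hence in M_J. *)
Lemma annihilator_basis J I u : lattice_basis B (annihilator J) ->
  I \in simplices D n -> J \subset I ->
  (forall j, j \in J -> pair u (rat_of_vec (v j)) = 0) ->
  exists c, u = c *m BQ.
Proof.
move=> [BE _] It JI uJ; have [N N0 [w wE]] := rat_row_scale u.
have NQ : (N%:~R : rat) != 0 by rewrite intr_eq0.
have /BE[c cE] : annihilator J w.
  move=> x xJ; apply/eqP; rewrite -(intr_eq0 rat) -pair_map -wE pairZl.
  rewrite (dual_vector_sum v_edge u It) pair_suml big1 ?mulr0 // => i iI.
  rewrite pairZl; have [/uJ ->|iJ] := boolP (i \in J); first by rewrite mul0r.
  by rewrite [X in _ * X](dual_cone_lattice v_edge It JI) ?mulr0.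
exists (N%:~R^-1 *: map_mx intr c); rewrite -scalemxAl -map_mxM -cE -wE.
by rewrite scalerA mulVf // scale1r.
Qed.

End LatticeBasis.

Section WedgeForm.
Variables (r n : nat) (B : 'M[rat]_(r, n)).
Implicit Types (A : 'M[rat]_(r.+1, n)) (u : 'rV[rat]_n).

(** The value of u /\ omega_J on the exterior product of the rows of [A]. *)
Definition wedge_det A u : rat := \det (stack u B *m A^T).

Lemma linear_form_eval N (a : 'rV[rat]_N) w :
  (linear_form a).@[w] = \sum_i a 0 i * w i.
Proof.
by rewrite /linear_form raddf_sum; apply: eq_bigr => i _ /=; rewrite mevalZ mevalXU.
Qed.

Lemma wedge_form_eval A u :
  (linear_form (wedge (stack u B))).@[fun t => wedge A 0 t] = wedge_det A u.
Proof. by rewrite linear_form_eval wedge_dot. Qed.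

Lemma wedge_det_functional A : exists2 d : 'rV[rat]_r.+1,
  forall u, wedge_det A u = pair d (u *m A^T) & forall c, pair d (c *m B *m A^T) = 0.
Proof.
have [d dE d0] := det_stack (B *m A^T); exists d => [u|c].
  by rewrite -dE; congr (\det _); exact: (mul_col_mx u B A^T).
by rewrite -mulmxA mulmx_sum_row pair_sumr big1 // => q _; rewrite pairZr d0 mulr0.
Qed.

Lemma wedge_stack0 : wedge (stack 0 B) = 0.
Proof.
apply/rowP => t; rewrite !mxE (expand_det_row _ 0) big1 // => a _.
by rewrite [X in X * _]mxE stack0E mxE mul0r.
Qed.

End WedgeForm.

Section PlaneEvaluation.
Variables (R : realType) (n : nat) (D : multifan R n).
Variable v : 'I_(nvert D) -> 'rV[int]_n.
Hypothesis v_edge : edge_vectors v.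
Notation s := (nvert D).
Variables (k : nat) (J I : {set 'I_s}) (B : 'M[int]_(n - k, n)).
Hypotheses (It : I \in simplices D n) (JI : J \subset I).
Hypothesis B_basis : lattice_basis B (annihilator J).
Implicit Types (A : 'M[rat]_((n - k).+1, n)) (u : 'rV[rat]_n) (m : 'X_{1..s}).

Notation BQ := (map_mx intr B : 'M[rat]_(n - k, n)).

Let IC : I \in complex D. Proof. by case/simplicesP: It. Qed.
Let JC : J \in complex D. Proof. exact: complex_sub IC JI. Qed.

Definition wedge_poly : {mpoly rat[s]} -> {mpoly rat[ext_dim (n - k).+1 n]} :=
  mmap (@mpolyC _ rat) (fun i => linear_form (wedge (stack (iota_vertex v I i) BQ))).
HB.instance Definition _ := GRing.RMorphism.on wedge_poly.

Lemma f_mu_class p : f_mu v I B (face_class D p) = wedge_poly p.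
Proof.
apply: face_eval_class => K KC.
have /subsetPn[i iK iI] : ~~ (K \subset I) by apply: contra KC; apply: complex_sub IC.
by rewrite (big_setD1 i) //= /iota_vertex (negPf iI) [wedge _]wedge_stack0 linear0
  mul0r.
Qed.

Lemma wedge_poly_homog p d : p \is d.-homog -> wedge_poly p \is d.-homog.
Proof. by move=> pd; apply: mmap_dhomog pd => i; apply: linear_form_homog. Qed.

(** f^J at the Pluecker point of the row space of [A]. *)
Definition plane_eval A p : rat := (wedge_poly p).@[fun t => wedge A 0 t].

Lemma plane_evalX A m : plane_eval A 'X_[m]
  = \prod_i wedge_det BQ A (iota_vertex v I i) ^+ m i.
Proof.
rewrite /plane_eval /wedge_poly mmapX /mmap1 rmorph_prod; apply: eq_bigr => i _.
by rewrite rmorphXn /= wedge_form_eval.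
Qed.

Lemma plane_evalE A p : plane_eval A p = \sum_(m <- msupp p) p@_m * plane_eval A 'X_[m].
Proof.
rewrite {1}[p]mpolyE /plane_eval (rmorph_sum wedge_poly) rmorph_sum;
  apply: eq_bigr => m _ /=.
by rewrite /wedge_poly mmapZ mevalM mevalC.
Qed.

(** For [i] in [I] but not in [J], the vector [u_i^I] lies in the span of M_J,
    so its product with omega_J is 0. *)
Lemma wedge_det_iota0 A i : i \notin J -> wedge_det BQ A (iota_vertex v I i) = 0.
Proof.
move=> iJ; have [d dE d0] := wedge_det_functional BQ A; rewrite dE /iota_vertex.
case: ifP => iI; last by rewrite mul0mx pair0r.
have [|c ->] := annihilator_basis (u := dual_vector v I i) v_edge B_basis It JI.
  move=> j jJ; rewrite dual_vectorP //; last exact: (fintype.subsetP JI).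
  by have -> : (i == j) = false by apply: contraNF iJ => /eqP ->.
exact: d0.
Qed.

Lemma plane_evalX_eq0 A m : ~~ (msupport m \subset J) -> plane_eval A 'X_[m] = 0.
Proof.
case/subsetPn => i; rewrite inE => mi iJ; rewrite plane_evalX (bigD1 i) //=.
by rewrite wedge_det_iota0 // expr0n (negPf mi) mul0r.
Qed.

Lemma plane_eval_simplex A : plane_eval A 'X_[mesym1 J]
  = \prod_(j in J) wedge_det BQ A (dual_vector v I j).
Proof.
rewrite plane_evalX [RHS]big_mkcond; apply: eq_bigr => i _.
rewrite mnmE /iota_vertex; have [iJ|iJ] := boolP (i \in J); last by rewrite expr0.
by rewrite (fintype.subsetP JI) // expr1.
Qed.

(** The class of [u] evaluates to [u] /\ omega_J, which depends on the rows of
    [A] only through the values of [u] and of the forms in omega_J on them. *)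
Lemma plane_eval_act A u m : u *m A^T = 0 ->
  \sum_l pair u (rat_of_vec (v l)) * plane_eval A 'X_[m + U_(l)] = 0.
Proof.
move=> uA; have [d dE _] := wedge_det_functional BQ A.
have : wedge_det BQ A u = 0 by rewrite dE uA pair0r.
rewrite {1}(dual_vector_sum v_edge u It) dE mulmx_suml pair_sumr => Gu.
transitivity (plane_eval A 'X_[m] * \sum_l pair u (rat_of_vec (v l))
  * wedge_det BQ A (iota_vertex v I l)).
  rewrite mulr_sumr; apply: eq_bigr => l _; rewrite mulrCA; congr (_ * _).
  by rewrite mpolyXD /plane_eval (rmorphM wedge_poly) mevalM -!/(plane_eval A _);
    congr (_ * _);
     rewrite plane_evalX (bigD1 l) //= big1 ?mulr1 => [|i il];
       rewrite mnm1E ?eqxx ?expr1 // eq_sym (negPf il).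
rewrite [X in _ * X](_ : _ = 0) ?mulr0 // -[RHS]Gu [RHS]big_mkcond;
  apply: eq_bigr => l _.
rewrite /iota_vertex; case: ifP => _; rewrite dE ?mul0mx ?pair0r ?mulr0 //.
by rewrite -scalemxAl pairZr.
Qed.

(** Correct the dual vector of [i] by a combination of the dual vector of [j0]
    and of the forms in omega_J. These forms vanish on the edge vectors of [J]
    other than that of [j0], and their values on the rows of [A] form an
    invertible matrix, so the correction can be chosen to kill all rows. *)
Lemma plane_separate A i j0 : i \in J -> j0 \in J ->
  wedge_det BQ A (dual_vector v I j0) != 0 ->
  exists2 u, u *m A^T = 0 &
    forall j, j \in J -> j != j0 -> pair u (rat_of_vec (v j)) = (i == j)%:R.
Proof.
move=> iJ j0J; set S := stack (dual_vector v I j0) BQ.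
rewrite /wedge_det -/S -unitfE -unitmxE => uS.
pose y := dual_vector v I i *m A^T *m invmx (S *m A^T).
exists (dual_vector v I i - y *m S).
  by rewrite mulmxBl -mulmxA mulmxKV // subrr.
move=> j jJ jj0; have jI := fintype.subsetP JI j jJ.
rewrite pairBl dual_vectorP //; last exact: (fintype.subsetP JI).
suff Sv : S *m (rat_of_vec (v j))^T = 0.
  by rewrite pair_mx -mulmxA Sv mulmx0 mxE subr0.
apply: etrans (mul_col_mx (dual_vector v I j0) BQ (rat_of_vec (v j))^T) _.
rewrite (basis_kills_edges v_edge B_basis) //.
have -> : dual_vector v I j0 *m (rat_of_vec (v j))^T = 0.
  apply/matrixP => a b; rewrite !ord1 -pair_mx dual_vectorP ?(fintype.subsetP JI) //.
  by rewrite mxE eq_sym (negPf jj0).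
exact: col_mx0.
Qed.

(** Take the plane spanned by the sum of the edge vectors of [J] and by vectors
    on which the forms in omega_J take the values of the unit matrix. *)
Lemma plane_generic : exists A, plane_eval A 'X_[mesym1 J] != 0.
Proof.
have Bfree := basis_row_free B_basis.
pose e : 'rV[rat]_n := \sum_(j in J) rat_of_vec (v j).
exists (col_mx e (pinvmx BQ)^T : 'M_((n - k).+1, n)).
rewrite plane_eval_simplex; apply/prodf_neq0 => j jJ;
  have jI := fintype.subsetP JI j jJ.
set V := row_mx (e^T) (pinvmx BQ);
  have -> : wedge_det BQ (col_mx e (pinvmx BQ)^T) (dual_vector v I j)
    = \det (col_mx (dual_vector v I j) BQ *m V).
  by rewrite /wedge_det /stack [(col_mx e _)^T](tr_col_mx e) trmxK.
rewrite /V mul_col_row.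
have -> : BQ *m e^T = 0.
  rewrite /e linear_sum mulmx_sumr big1 // => j' j'J.
  exact: (basis_kills_edges v_edge B_basis).
rewrite mulmxVp // det_ublock det1 mulr1 det_mx11 -pair_mx /e pair_sumr (bigD1 j) //=.
rewrite dual_vectorP // eqxx big1 ?addr0 ?oner_neq0 // => j' /andP[j'J ne].
rewrite dual_vectorP //; last exact: (fintype.subsetP JI).
by rewrite eq_sym (negPf ne).
Qed.

End PlaneEvaluation.

(** * Expansion of the push-forward at a generic plane *)

Section Expansion.
Variables (R : realType) (n : nat) (D : multifan R n).
Hypothesis Dcomplete : complete D.
Variable v : 'I_(nvert D) -> 'rV[int]_n.
Hypothesis v_edge : edge_vectors v.
Notation s := (nvert D).
Variables (F : fieldType) (phi : {rmorphism {mpoly rat[n]} -> F}).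
Hypothesis phi_eq0 : forall p, (phi p == 0) = (p == 0).
Variable ell : {mpoly rat[s]} -> rat.
Hypothesis ell_push : forall p, p \is n.-homog -> const_image phi (ell p)
  = push_poly v phi p.
Variables (k : nat).
Hypothesis k_le_n : (k <= n)%N.
Variables (g : {mpoly rat[s]}).
Hypothesis g_deg : g \is (n - k).-homog.
Implicit Types (I J K : {set 'I_s}) (p q : {mpoly rat[s]}) (m : 'X_{1..s}).

(** [ell] stands for p_* in degree [n], and [shifted] for p_*(g .). *)
Definition shifted p : rat := ell (g * p).

Lemma shiftedE p : p \is k.-homog -> const_image phi (shifted p)
  = push_poly v phi (g * p).
Proof.
move=> pk; rewrite /shifted ell_push //.
suff : g * p \is (n - k + k).-homog by rewrite subnK.
exact: dhomogM.
Qed.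

Lemma shifted_sum (T : eqType) (r : seq T) (c : T -> rat) (p : T -> {mpoly rat[s]}) :
  (forall t, t \in r -> p t \is k.-homog) ->
  shifted (\sum_(t <- r) c t *: p t) = \sum_(t <- r) c t * shifted (p t).
Proof.
move=> pk; apply: (fmorph_inj (const_image phi)); rewrite /= shiftedE; last first.
  by rewrite big_seq; apply: rpred_sum => t /pk pt; rewrite dhomogZ.
rewrite mulr_sumr rmorph_sum /=; under eq_bigr do rewrite -scalerAr.
rewrite push_poly_sum [LHS]big_seq [RHS]big_seq; apply: eq_bigr => t /pk pt.
by rewrite rmorphM /= shiftedE.
Qed.

(** The other factors have total degree [n - 1], where pi_* vanishes. *)
Lemma shifted_act u m : (mdeg m).+1 = k ->
  \sum_l pair u (rat_of_vec (v l)) * shifted 'X_[m + U_(l)] = 0.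
Proof.
move=> mk; rewrite -shifted_sum => [|l _];
  last by rewrite dhomogX /= mdegD mdeg1 addn1 mk.
apply: (fmorph_inj (const_image phi)); rewrite /= -actX shiftedE; last first.
  rewrite actX; apply: rpred_sum => l _.
  by rewrite dhomogZ // dhomogX /= mdegD mdeg1 addn1 mk.
rewrite rmorph0 mulrCA push_poly_act //.
rewrite (push_homog_vanish Dcomplete v_edge phi_eq0 (d :=
  (n - k + mdeg m)%N)) ?mulr0 //.
  by apply: dhomogM => //; rewrite dhomogX.
by lia.
Qed.

Variables (I_ : {set 'I_s} -> {set 'I_s}) (B_ : {set 'I_s} -> 'M[int]_(n - k, n)).
Hypothesis I_top : forall J, J \in simplices D k ->
     I_ J \in simplices D n /\ J \subset I_ J.
Hypothesis B_basis : forall J, J \in simplices D k ->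
     lattice_basis (B_ J) (annihilator J).

Section GenericPlane.
Variable A : 'M[rat]_((n - k).+1, n).
Notation evalA J := (plane_eval v (I_ J) (B_ J) A).
Hypothesis A_generic : forall J, J \in simplices D k -> evalA J 'X_[mesym1 J] != 0.

(** Exchange argument in degree [k] for the difference of both sides. It kills
    [x_K], [K] in Sigma^(k), because [x_K] evaluates to 0 in the summand of every
    [J] other than [K]. It also kills the relations of the forms [u] that vanish
    on the rows of [A]: the left-hand side by [shifted_act], the right-hand side
    by [plane_eval_act]. As [A] is generic, [plane_separate] provides the
    relation that trades a repeated vertex for vertices off the support. *)
Lemma expansionX m : mdeg m = k ->
  shifted 'X_[m] = \sum_(J in simplices D k) evalA J 'X_[m] / evalA J 'X_[mesym1 J]
    * shifted 'X_[mesym1 J].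
Proof.
pose T m := shifted 'X_[m] - \sum_(J in simplices D k)
  evalA J 'X_[m] / evalA J 'X_[mesym1 J] * shifted 'X_[mesym1 J].
move=> mk; apply/eqP; rewrite -subr_eq0 -/(T m); apply/eqP; move: m mk.
apply: (@face_monomial_ind _ (complex D) k (fun m => T m = 0)) =>
  [m mk mC|K KC cK|m i mC cm im mk Tl].
- rewrite /T big1 ?subr0 => [|J /[dup] Jk /simplicesP[JC _]].
    apply: (fmorph_inj (const_image phi)); rewrite /= shiftedE;
      last by rewrite dhomogX; apply/eqP.
    by rewrite push_nonface // rmorph0.
  have [It JI] := I_top Jk.
  rewrite (plane_evalX_eq0 v_edge It JI (B_basis Jk)) ?mul0r //.
  by apply: contra mC; apply: complex_sub JC.
- have Kk : K \in simplices D k by apply/simplicesP.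
  rewrite /T (bigD1 K) //= divff ?A_generic // mul1r big1 ?addr0 ?subrr // =>
    J /andP[Jk JK].
  have [It JI] := I_top Jk.
  rewrite (plane_evalX_eq0 v_edge It JI (B_basis Jk)) ?mul0r ?msupport_mesym1 //.
  apply: contra JK => KJ; rewrite eq_sym eqEcard KJ cK.
  by have /simplicesP[_ cJ] := Jk; rewrite cJ leqnn.
(* The forms that vanish on the rows of [A] have, in general, dimension [k - 1].
   So among the [k] vertices of a simplex [J] that contains the support, one
   vertex [j0] off the support is left where the form is not prescribed. *)
have [I [IC cI mI]] := complex_pure mC.
have [||J [mJ JI cJ]] := @subset_card_between _ (msupport m) I k mI; rewrite ?cI //;
  first exact: ltnW.
have Jk : J \in simplices D k by apply/simplicesP; split=> //; apply: complex_sub IC JI.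
have [It JIJ] := I_top Jk.
have /subsetPn[j0 j0J j0m] : ~~ (J \subset msupport m).
  by apply/negP => /subset_leq_card; rewrite cJ leqNgt cm.
have := A_generic Jk; rewrite (plane_eval_simplex _ _ JIJ).
move/prodf_neq0/(_ j0 j0J) => G0.
have iJ := fintype.subsetP mJ i im.
have [u uA uv] := plane_separate v_edge It JIJ (B_basis Jk) iJ j0J G0.
have : \sum_l pair u (rat_of_vec (v l)) * T (m + U_(l))%MM = 0.
  rewrite /T; under eq_bigr do rewrite mulrBr.
  rewrite sumrB shifted_act // sub0r; apply/eqP; rewrite oppr_eq0; apply/eqP.
  under eq_bigr do rewrite mulr_sumr.
  rewrite exchange_big big1 //= => K Kk; have [IKt KI] := I_top Kk.
  transitivity ((\sum_l pair u (rat_of_vec (v l)) * evalA K 'X_[m + U_(l)])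
     * ((evalA K 'X_[mesym1 K])^-1 * shifted 'X_[mesym1 K])).
    by rewrite mulr_suml; apply: eq_bigr => l _; rewrite !mulrA.
  by rewrite (plane_eval_act v_edge _ IKt) ?mul0r.
rewrite (bigID (mem (msupport m))) /= [X in _ + X]big1 ?addr0 => [|l /Tl ->];
  last by rewrite mulr0.
rewrite (bigD1 i) //= uv ?eqxx //; last by apply: contraNneq j0m => <-.
rewrite mul1r big1 ?addr0 // => j /andP[jm ji].
rewrite uv ?(fintype.subsetP mJ) //; last by apply: contraNneq j0m => <-.
by rewrite eq_sym (negPf ji) mul0r.
Qed.

Lemma expansion p : p \is k.-homog ->
  shifted p = \sum_(J in simplices D k) evalA J p / evalA J 'X_[mesym1 J]
    * shifted 'X_[mesym1 J].
Proof.
move=> /dhomogP pk; rewrite {1}[p]mpolyE shifted_sum => [|m /pk mk];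
  last by rewrite dhomogX; apply/eqP.
rewrite big_seq; under eq_bigr => m /pk mk do rewrite expansionX // mulr_sumr.
rewrite exchange_big; apply: eq_bigr => J Jk /=.
rewrite -big_seq [evalA J p]plane_evalE !mulr_suml; apply: eq_bigr => m _.
by rewrite !mulrA.
Qed.
End GenericPlane.
End Expansion.

(** * The identity of rational functions *)

Section DegreeZeroIdentity.
Variables (N : nat) (F : fieldType) (phi : {rmorphism {mpoly rat[N]} -> F}).
Variables (T : finType) (S : {set T}) (d : nat) (P Q : T -> {mpoly rat[N]}).
Variables (c : rat) (b : T -> rat).
Hypothesis P_deg : forall t, t \in S -> P t \is d.-homog.
Hypothesis Q_deg : forall t, t \in S -> Q t \is d.-homog.
Hypothesis Q_neq0 : forall t, t \in S -> phi (Q t) != 0.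

(** The additional factor in the hypothesis makes the polynomial there vanish
    wherever one of the denominators [Q t] does, so that it only has to be
    examined at the points where all of them are invertible. *)
Lemma degree0_identity :
  phi (\prod_(t in S) Q t * (c%:MP * \prod_(t in S) Q t
     - \sum_(t in S) P t * (b t)%:MP * \prod_(t' in S | t' != t) Q t')) = 0 ->
  degree0_const phi c = \sum_(t in S) degree0_frac phi (P t) (Q t)
    * degree0_const phi (b t).
Proof.
move=> id0; apply: val_inj; rewrite (rmorph_sum val) /= degree0_constE.
set W := \prod_(t in S) Q t in id0.
have W0 : phi W != 0 by rewrite rmorph_prod; apply/prodf_neq0.
apply: (mulIf W0); apply/eqP; rewrite -subr_eq0.
move/eqP: id0; rewrite rmorphM mulf_eq0 (negPf W0) /= rmorphB rmorphM /=.
congr (_ - _ == _); rewrite mulr_suml rmorph_sum; apply: eq_bigr => t tS.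
rewrite degree0_constE (degree0_fracE (P_deg tS) (Q_deg tS) (Q_neq0 tS)).
rewrite /W [in RHS](bigD1 t) //= !(rmorphM phi) /=; field.
exact: Q_neq0.
Qed.

End DegreeZeroIdentity.

Lemma face_monomialE (R : realType) n (D : multifan R n) (J : {set 'I_(nvert D)}) :
  face_monomial D J = face_class D 'X_[mesym1 J].
Proof.
rewrite /face_monomial mpolyXE_id big_mkcond; congr face_class; apply: eq_bigr => i _.
by rewrite mnmE; case: (i \in J).
Qed.

(** Only the term of total degree [n] of the exponential series survives. *)
Lemma push_p_exp_class (R : realType) n (D : multifan R n) (v : 'I_(nvert D) ->
  'rV[int]_n)
    (v_edge : edge_vectors v) k (p q : {mpoly rat[nvert D]}) :
  (k <= n)%N -> p \is k.-homog -> q \is 1.-homog ->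
  push_p_exp v (face_class D q) (face_class D p)
  = ((n - k)`!%:R)^-1 * push_p v (face_class D (q ^+ (n - k) * p)).
Proof.
move=> kn pk q1; have lt_nk : (n - k < n.+1)%N by rewrite ltnS leq_subr.
have classXM j : face_class D q ^+ j * face_class D p = face_class D (q ^+ j * p).
  rewrite -(rmorphXn (\pi_({ideal_quot (@face_ideal R n D)})%qT)). exact/esym/rmorphM.
rewrite /push_p_exp (bigD1 (Ordinal lt_nk)) //= classXM big1 ?addr0 // => j jnk.
rewrite classXM (@push_p_homog_neq _ _ _ _ v_edge _ (j + k)%N) ?mulr0 //.
  by rewrite -[X in (X + _)%N]mul1n; apply: dhomogM => //; apply: dhomogMn.
apply: contra jnk => /eqP jk; apply/eqP/val_inj => /=; lia.
Qed.

Theorem theorem3p1 (R : realType) (n : nat) (D : multifan R n)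
  (Dcomplete : complete D)
  (v : 'I_(nvert D) -> 'rV[int]_n) (v_edge : edge_vectors v)
  (k : nat) (k_gt0 : (0 < k)%N) (k_le_n : (k <= n)%N)
  (x : face_ring D) (x_deg : face_degree k x)
  (I_ : {set 'I_(nvert D)} -> {set 'I_(nvert D)})
  (I_top : forall J, J \in simplices D k ->
     I_ J \in simplices D n /\ J \subset I_ J)
  (B_ : {set 'I_(nvert D)} -> 'M[int]_(n - k, n))
  (B_basis : forall J, J \in simplices D k ->
     lattice_basis (B_ J) (annihilator J))
  (xi : face_ring D) (xi_deg : face_degree 1 xi) :
  grass_const (n - k).+1 n (push_p_exp v xi x)
  = \sum_(J in simplices D k)
      mu v (I_ J) (B_ J) x J
      * grass_const (n - k).+1 n (push_p_exp v xi (face_monomial D J)).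
Proof.
have [p pk ->] := x_deg; have [q q1 ->] := xi_deg.
have Xk J : J \in simplices D k -> ('X_[mesym1 J] : {mpoly rat[nvert D]}) \is k.-homog.
  by move=> /simplicesP[_ cJ]; rewrite dhomogX /= mdeg_mesym1 cJ.
pose f J := wedge_poly v (I_ J) (B_ J).
pose a : rat := ((n - k)`!%:R)^-1.
pose ell (r : {mpoly rat[nvert D]}) := push_p v (face_class D r).
pose g : {mpoly rat[nvert D]} := q ^+ (n - k).
have gk : g \is (n - k).-homog by rewrite -[X in X.-homog]mul1n; apply: dhomogMn.
rewrite (push_p_exp_class v_edge k_le_n pk q1).
transitivity (\sum_(J in simplices D k)
   degree0_frac (@grass_pullback (n - k).+1 n) (f J p) (f J 'X_[mesym1 J])
     * grass_const (n - k).+1 n (a * shifted ell g 'X_[mesym1 J])); last first.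
  apply: eq_bigr => J Jk; have [It JI] := I_top J Jk.
  rewrite /mu face_monomialE !(f_mu_class _ _ It).
  by rewrite (push_p_exp_class v_edge k_le_n (Xk J Jk) q1).
have f_neq0 J : J \in simplices D k ->
  @grass_pullback (n - k).+1 n (f J 'X_[mesym1 J]) != 0.
  move=> Jk; have [It JI] := I_top J Jk.
  have [A A0] := plane_generic v_edge It JI (B_basis J Jk).
  by rewrite grass_pullback_eq0; apply/negP => /asboolP /(_ A) /eqP; apply/negP.
apply: (@degree0_identity _ _ _ _ _ k) => [J Jk|J Jk|//|].
- exact: wedge_poly_homog.
- exact: wedge_poly_homog (Xk J Jk).
apply/eqP; rewrite grass_pullback_eq0; apply/asboolP => A.
rewrite mevalM; set W := _.@[_]; have [->|W0] := eqVneq W 0; first by rewrite mul0r.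
rewrite mevalB mevalM mevalC -/W.
have evalW J : J \in simplices D k -> plane_eval v (I_ J) (B_ J) A 'X_[mesym1 J] != 0.
  move=> Jk; apply: contra W0 => /eqP e0.
  by rewrite /W rmorph_prod (bigD1 J) //= -/(plane_eval v (I_ J) (B_ J) A _) e0 mul0r.
have ell_push r : r \is n.-homog ->
    const_image (@tofrac {mpoly rat[n]}) (ell r)
      = push_poly v (@tofrac {mpoly rat[n]}) r.
  by move=> rn; rewrite push_p_homog.
have expand := expansion Dcomplete v_edge (@tofrac_eq0 _) ell_push k_le_n gk
  I_top B_basis evalW pk.
have -> : push_p v (face_class D (q ^+ (n - k) * p)) = shifted ell g p by [].
have sumE : (\sum_(J in simplices D k) f J p * (a * shifted ell g 'X_[mesym1 J])%:MP
      * \prod_(K in simplices D k | K != J) f K 'X_[mesym1 K]).@[fun t => wedge A 0 t]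
    = \sum_(J in simplices D k) plane_eval v (I_ J) (B_ J) A p * (a
      * shifted ell g 'X_[mesym1 J])
      * (\prod_(K in simplices D k | K != J) f K 'X_[mesym1 K]).@[fun t => wedge A 0 t].
  by rewrite raddf_sum; apply: eq_bigr => J _; rewrite /= !mevalM mevalC.
have WE J : J \in simplices D k -> W = plane_eval v (I_ J) (B_ J) A 'X_[mesym1 J]
    * (\prod_(K in simplices D k | K != J) f K 'X_[mesym1 K]).@[fun t => wedge A 0 t].
  by move=> Jk; rewrite /W (bigD1 J Jk) mevalM.
rewrite sumE expand; clearbody W.
rewrite mulr_sumr mulr_suml -sumrB big1 ?mulr0 // => J Jk.
rewrite (WE J Jk) -/a; move: (meval _ _) (evalW J Jk) => c e0; field.
exact: e0.
Qed.
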